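(* Let $d\in C^1(\mathbb{R})$ with $d(0)=0$, $d'(m)>d_0$ and $|d'(m)|\le d_1+d_2|m|^p$ for all $m\in\mathbb{R}$, for constants $d_0>0$, $d_1,d_2,p\ge0$. Let $\bar f,\bar g\in L^2(0,1)$, $\bar h=(\bar h(0),\bar h(1))\in\mathbb{R}^2$, $p_0,m_0\in H^1(0,1)$, $T>0$, and let $(p,m)\in C(0,T;H^1\times H^1)\cap C^1(0,T;L^2\times L^2)$ be the unique solution of $$\partial_t p+\partial_x m=\bar f,\qquad \partial_t m+\partial_x p+d(m)=\bar g\quad\text{in }(0,1)\times[0,T],\qquad p(x,t)=\bar h(x)\ \text{for }x\in\{0,1\},\ t\in[0,T],$$ with $p(0)=p_0$, $m(0)=m_0$. Let $(\bar p,\bar m)\in H^1(0,1)\times H^1(0,1)$ be the (unique) steady state, i.e. the solution of $\partial_x\bar m=\bar f$, $\partial_x\bar p+d(\bar m)=\bar g$ in $(0,1)$, $\bar p=\bar h$ at $x\in\{0,1\}$. Then for $0\le t\le T$, $$E(p(t)-\bar p,m(t)-\bar m)\le c e^{-\gamma t}\quad\text{and}\quad E(\partial_t p(t),\partial_t m(t))\le c'e^{-\gamma t},$$ with constants $c,c',\gamma>0$ depending only on $\|\bar f\|_{L^2},\|\bar g\|_{L^2},|\bar h|,\|p_0\|_{H^1},\|m_0\|_{H^1}$.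
   Context: $E(q,v):=\tfrac12\|q\|_{L^2}^2+\tfrac12\|v\|_{L^2}^2$. $p(t)$ denotes $x\mapsto p(x,t)$; $|\bar h|$ denotes a norm of $\bar h\in\mathbb{R}^2$. *)

(* Defs.v *)
From HB Require Import structures.
From mathcomp Require Import all_boot all_order all_algebra.
From mathcomp Require Import all_classical all_reals all_analysis.
Set Implicit Arguments. Unset Strict Implicit. Unset Printing Implicit Defensive.
Import Order.TTheory GRing.Theory Num.Theory.
Import numFieldNormedType.Exports.
Local Open Scope classical_set_scope.
Local Open Scope ring_scope.

(* The space interval (0,1) (closed version; endpoints are null sets). *)
Definition I01 {R : realType} : set R := `[0%R, 1%R].

Definition L2 {R : realType} (f : R -> R) : Prop :=
  measurable_fun I01 f /\
  (@lebesgue_measure R).-integrable I01 (fun x => ((f x) ^+ 2)%:E).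

Definition L2norm2 {R : realType} (f : R -> R) : R :=
  \int[@lebesgue_measure R]_(x in I01) ((f x) ^+ 2).

Definition L2norm {R : realType} (f : R -> R) : R := Num.sqrt (L2norm2 f).

Definition E {R : realType} (q v : R -> R) : R :=
  L2norm2 q / 2 + L2norm2 v / 2.

(* H1 f f' : f belongs to H^1(0,1) (represented by its continuous
   representative) and f' in L^2(0,1) is its (weak) derivative:
   f x = f 0 + int_0^x f'  for every x in [0,1]. *)
Definition H1 {R : realType} (f f' : R -> R) : Prop :=
  L2 f /\ L2 f' /\
  forall x, I01 x -> f x = f 0 + \int[@lebesgue_measure R]_(y in `[0%R, x]) f' y.

Definition H1norm {R : realType} (f f' : R -> R) : R :=
  Num.sqrt (L2norm2 f + L2norm2 f').

Definition ae01 {R : realType} (P : R -> Prop) : Prop :=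
  {ae @lebesgue_measure R, forall x, I01 x -> P x}.

Definition IT {R : realType} (T : R) : set R := `[0%R, T].

Definition cont_H1 {R : realType} (T : R) (u ux : R -> R -> R) : Prop :=
  forall t, IT T t -> forall e : R, 0 < e -> exists2 del : R, 0 < del &
    forall s, IT T s -> `|s - t| < del ->
      L2norm2 (fun x => u x s - u x t) + L2norm2 (fun x => ux x s - ux x t) < e.

Definition cont_L2 {R : realType} (T : R) (u : R -> R -> R) : Prop :=
  forall t, IT T t -> forall e : R, 0 < e -> exists2 del : R, 0 < del &
    forall s, IT T s -> `|s - t| < del -> L2norm2 (fun x => u x s - u x t) < e.

Definition deriv_L2 {R : realType} (T : R) (u ut : R -> R -> R) : Prop :=
  forall t, IT T t -> forall e : R, 0 < e -> exists2 del : R, 0 < del &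
    forall s, IT T s -> 0 < `|s - t| < del ->
      L2norm2 (fun x => (u x s - u x t) / (s - t) - ut x t) < e.

Definition is_solution {R : realType} (d : R -> R) (fb gb : R -> R)
    (h0 h1 : R) (p0 m0 : R -> R) (T : R)
    (p m px mx pt mt : R -> R -> R) : Prop :=
  [/\ (forall t, IT T t -> H1 (fun x => p x t) (fun x => px x t) /\
                           H1 (fun x => m x t) (fun x => mx x t)) /\
      (cont_H1 T p px /\ cont_H1 T m mx),
      [/\ (forall t, IT T t -> L2 (fun x => pt x t) /\ L2 (fun x => mt x t)),
          deriv_L2 T p pt /\ deriv_L2 T m mt &
          cont_L2 T pt /\ cont_L2 T mt],
      (forall t, IT T t -> ae01 (fun x =>
            pt x t + mx x t = fb x /\ mt x t + px x t + d (m x t) = gb x)),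
      (forall t, IT T t -> p 0 t = h0 /\ p 1 t = h1) &
      (forall x, I01 x -> p x 0 = p0 x /\ m x 0 = m0 x)].

Definition is_steady {R : realType} (d : R -> R) (fb gb : R -> R)
    (h0 h1 : R) (pb mb pbx mbx : R -> R) : Prop :=
  [/\ H1 pb pbx, H1 mb mbx,
      ae01 (fun x => mbx x = fb x /\ pbx x + d (mb x) = gb x) &
      pb 0 = h0 /\ pb 1 = h1].

(* Main.v *)
(* For the difference (q, v) of two solutions, q_t + v_x = 0, v_t + q_x + r = 0 and
   q = 0 at the boundary, with r = d(m) - d(m'), so E(q, v)' = -(r, v) <= -d0 |v|^2.
   To also dissipate q, subtract from E a small multiple of (v, Q), with Q the
   mean-zero primitive of q: since Q_t = -(v - mean v), the derivative of (v, Q) is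
   |q|^2 - (r, Q) - |v|^2 + (mean v)^2.  If |r| <= D |v| this gives exponential
   decay at a rate depending only on d0 and D.

   As m_t is only continuous in time, the estimate for (p_t, m_t) comes from
   comparing the solution with its time shifts, dividing by the shift h and letting
   h tend to 0.  Plain monotonicity (D not needed) first bounds (p_t, m_t) by its
   initial value; since (m - mb)_x = -p_t, this bounds m uniformly, hence D, after
   which the same comparison yields the decay. *)
Require Import Defs.
From HB Require Import structures.
From mathcomp Require Import all_boot all_order all_algebra.
From mathcomp Require Import all_classical all_reals all_analysis.
From mathcomp Require Import measurable_realfun ring lra.
Import Order.TTheory GRing.Theory Num.Theory.
Import numFieldNormedType.Exports.
Local Open Scope classical_set_scope.
Local Open Scope ring_scope.
Set Implicit Arguments.
Unset Strict Implicit.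

(** * The space L^2(0,1): inner product, norm, almost-everywhere comparison *)

Section L2_space.
Context {R : realType}.
Implicit Types (f g h : R -> R) (a b : R).
Notation mu := (@lebesgue_measure R).

(** The flux difference v satisfies no boundary condition. The plain primitive of q starting at 0
    has time derivative -(v - v(0)), and the unknown value v(0) would enter the estimate; removing
    the mean eliminates it. The price is (mean v)^2, which has a favourable sign because the cross
    term is subtracted from E. The derivative of [d] may grow polynomially, so a Lipschitz constant
    exists only on bounded ranges of m; the embedding of H^1 into bounded functions in one dimension
    supplies such a range. A forward shift of a solution solves the same system, and so does a
    steady state regarded as constant in time. Hence a single comparison of two trajectories gives
    both decay statements. The constants must be functions of the five norms, fixed before the data,
    the solution and [T]. For this reason the steady state and the initial velocity are also bounded
    explicitly by the data. *)

Definition ip f g : R := \int[mu]_(x in I01) (f x * g x).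

Lemma ip_L2norm2 f : ip f f = L2norm2 f.
Proof. by []. Qed.

Lemma measurable_I01 : measurable (@I01 R).
Proof. exact: measurable_itv. Qed.
Hint Resolve measurable_I01 : core.

Lemma lebesgue_I01 : mu (@I01 R) = 1%:E.
Proof. by rewrite /I01 lebesgue_measure_itv/= lte_fin ltr01 -EFinB subr0. Qed.

Lemma L2M f g : L2 f -> L2 g -> mu.-integrable I01 (EFin \o (fun x => f x * g x)).
Proof.
move=> [mf f2] [mg g2].
apply: (@le_integrable _ _ _ mu I01 measurable_I01 _
  (fun x => (f x ^+ 2)%:E + (g x ^+ 2)%:E)%E).
- by apply/measurable_EFinP; exact: measurable_funM.
- move=> x _ /=; rewrite lee_fin [leRHS]ger0_norm ?addr_ge0 ?sqr_ge0//.
  rewrite ler_norml; apply/andP; split; nra.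
- exact: integrableD.
Qed.

Lemma L2_cst a : L2 (cst a : R -> R).
Proof.
split; first exact: measurable_cst.
rewrite (_ : (fun x => _) = cst (a ^+ 2)%:E)//.
apply/integrableP; split; first exact: measurable_cst.
rewrite integral_cst//= lebesgue_I01 mule1 ltry//.
Qed.

Lemma L2_integrable f : L2 f -> mu.-integrable I01 (EFin \o f).
Proof.
move=> f2; apply: eq_integrable (L2M f2 (L2_cst 1)); first exact: measurable_I01.
by move=> x _ /=; rewrite mulr1.
Qed.

Lemma L2D f g : L2 f -> L2 g -> L2 (f + g).
Proof.
move=> f2 g2; split; first by apply: measurable_funD; [case: f2|case: g2].
apply: (@eq_integrable _ _ _ mu I01 measurable_I01
  (fun x => (f x ^+ 2)%:E + ((f x * g x)%:E + (f x * g x)%:E) + (g x ^+ 2)%:E)%E) => //.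
  by move=> x _; rewrite -!EFinD; congr EFin; rewrite fctE; ring.
by repeat apply: integrableD => //; [case: f2|exact: L2M|exact: L2M|case: g2].
Qed.

Lemma L2Z a f : L2 f -> L2 (a *: f).
Proof.
move=> f2; split; first by apply: measurable_funM => //; case: f2.
apply: (@eq_integrable _ _ _ mu I01 measurable_I01 (fun x => (a ^+ 2)%:E * (f x ^+ 2)%:E)%E) => //.
  by move=> x _; rewrite -EFinM; congr EFin; rewrite fctE /GRing.scale /=; ring.
by apply: integrableZl => //; case: f2.
Qed.

Lemma L2N f : L2 f -> L2 (- f).
Proof. by move=> f2; rewrite -scaleN1r; exact: L2Z. Qed.

Lemma L2B f g : L2 f -> L2 g -> L2 (f - g).
Proof. by move=> f2 g2; apply: L2D => //; exact: L2N. Qed.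

Lemma ipC f g : ip f g = ip g f.
Proof. by apply: eq_Rintegral => x _; rewrite mulrC. Qed.

Lemma ipDl f g h : L2 f -> L2 g -> L2 h -> ip (f + g) h = ip f h + ip g h.
Proof.
move=> f2 g2 h2; rewrite -RintegralD//; [|exact: L2M|exact: L2M].
by apply: eq_Rintegral => x _; rewrite fctE mulrDl.
Qed.

Lemma ipZl a f h : L2 f -> L2 h -> ip (a *: f) h = a * ip f h.
Proof.
move=> f2 h2; rewrite -RintegralZl//; [|exact: L2M].
by apply: eq_Rintegral => x _; rewrite fctE mulrA.
Qed.

Lemma ipNl f h : L2 f -> L2 h -> ip (- f) h = - ip f h.
Proof. by move=> f2 h2; rewrite -scaleN1r ipZl// mulN1r. Qed.

Lemma ipBl f g h : L2 f -> L2 g -> L2 h -> ip (f - g) h = ip f h - ip g h.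
Proof. by move=> f2 g2 h2; rewrite ipDl// ?ipNl//; exact: L2N. Qed.

Lemma ipDr f g h : L2 f -> L2 g -> L2 h -> ip h (f + g) = ip h f + ip h g.
Proof. by move=> f2 g2 h2; rewrite ipC ipDl// !(ipC h). Qed.

Lemma ipZr a f h : L2 f -> L2 h -> ip h (a *: f) = a * ip h f.
Proof. by move=> f2 h2; rewrite ipC ipZl// (ipC h). Qed.

Lemma ipBr f g h : L2 f -> L2 g -> L2 h -> ip h (f - g) = ip h f - ip h g.
Proof. by move=> f2 g2 h2; rewrite ipC ipBl// !(ipC h). Qed.

Lemma ip_ge0 f : 0 <= ip f f.
Proof. by apply: Rintegral_ge0 => x _; rewrite -expr2 sqr_ge0. Qed.

Lemma L2norm_ge0 f : 0 <= L2norm f.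
Proof. exact: sqrtr_ge0. Qed.

Lemma sqr_L2norm f : L2norm f ^+ 2 = ip f f.
Proof. by rewrite sqr_sqrtr// ip_ge0. Qed.

Lemma ip_cst a b : ip (cst a) (cst b) = a * b.
Proof.
have -> : ip (cst a) (cst b) = \int[mu]_(x in I01) (a * b) by [].
by rewrite Rintegral_cst// [X in fine X]lebesgue_I01 mulr1.
Qed.

Lemma cauchy_schwarz_L2 f g : L2 f -> L2 g -> `|ip f g| <= L2norm f * L2norm g.
Proof.
move=> f2 g2.
have q l : 0 <= ip f f + 2 * l * ip f g + l ^+ 2 * ip g g.
  have := ip_ge0 (f + l *: g); have lg := L2Z l g2.
  rewrite ipDl//; last exact: L2D.
  rewrite !ipDr// ipZl// !ipZr// ipZl// (ipC g f); congr (_ <= _); ring.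
rewrite -ler_sqr ?nnegrE ?mulr_ge0 ?L2norm_ge0// exprMn !sqr_L2norm real_normK ?num_real//.
have := ip_ge0 g; rewrite le_eqVlt => /orP[/eqP g0|g0].
  rewrite -g0 mulr0; have [->|fg0] := eqVneq (ip f g) 0; first by rewrite expr0n.
  (* With [ip g g = 0] the quadratic [q] is affine in [l], and this [l] gives it the value [-1]. *)
  have := q (- (ip f f + 1) / (2 * ip f g)); rewrite -g0 mulr0 addr0.
  rewrite (_ : 2 * _ * _ = - (ip f f + 1)); first by lra.
  by field.
(* The minimiser of the quadratic. *)
have := q (- ip f g / ip g g).
rewrite (_ : _ + _ = ip f f - ip f g ^+ 2 / ip g g); last by field; rewrite gt_eqF.
by rewrite subr_ge0 ler_pdivrMr.
Qed.

Lemma L2normD f g : L2 f -> L2 g -> L2norm (f + g) <= L2norm f + L2norm g.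
Proof.
move=> f2 g2; have fg := L2D f2 g2.
rewrite -ler_sqr ?nnegrE ?addr_ge0 ?L2norm_ge0//.
rewrite sqr_L2norm ipDl// !ipDr// (ipC g f) sqrrD !sqr_L2norm.
by have := cauchy_schwarz_L2 f2 g2; have := ler_norm (ip f g); lra.
Qed.

Lemma L2normZ a f : L2 f -> L2norm (a *: f) = `|a| * L2norm f.
Proof.
move=> f2; apply/eqP; rewrite -(@eqrXn2 _ 2)// ?mulr_ge0 ?L2norm_ge0//.
rewrite exprMn !sqr_L2norm ipZl ?ipZr ?real_normK ?num_real//; last exact: L2Z.
by rewrite mulrA.
Qed.

Lemma L2normN f : L2 f -> L2norm (- f) = L2norm f.
Proof. by move=> f2; rewrite -scaleN1r L2normZ// normrN1 mul1r. Qed.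

Lemma L2normB f g : L2 f -> L2 g -> L2norm (f - g) <= L2norm f + L2norm g.
Proof. by move=> f2 g2; rewrite -(L2normN g2) L2normD//; exact: L2N. Qed.

Lemma L2norm_cst a : L2norm (cst a) = `|a|.
Proof. by rewrite /L2norm -ip_L2norm2 ip_cst -expr2 sqrtr_sqr. Qed.

Lemma ae01_sub (P Q : R -> Prop) :
  (forall x, I01 x -> P x -> Q x) -> ae01 P -> ae01 Q.
Proof.
move=> PQ; rewrite /ae01; apply: filterS; first exact: (ae_filter_ringOfSetsType mu).
move=> x Px Ix; apply: PQ => //; exact: Px.
Qed.

Lemma ae01_and (P Q : R -> Prop) :
  ae01 P -> ae01 Q -> ae01 (fun x => P x /\ Q x).
Proof.
rewrite /ae01; apply: filterS2; first exact: (ae_filter_ringOfSetsType mu).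
move=> x Px Qx Ix; split; [exact: Px|exact: Qx].
Qed.

Lemma ip_ae f g h : L2 f -> L2 g -> L2 h -> ae01 (fun x => f x = g x) ->
  ip f h = ip g h.
Proof.
move=> f2 g2 h2 fg; congr fine; apply: ae_eq_integral => //.
- by have /integrableP[] := L2M f2 h2.
- by have /integrableP[] := L2M g2 h2.
- by apply: (ae01_sub _ fg) => x _ /= ->.
Qed.

(** The difference [g - f] agrees almost everywhere with its positive part, which is nonnegative at
    every point. *)
Lemma ae_le_Rintegral f g : mu.-integrable I01 (EFin \o f) ->
  mu.-integrable I01 (EFin \o g) -> ae01 (fun x => f x <= g x) ->
  \int[mu]_(x in I01) f x <= \int[mu]_(x in I01) g x.
Proof.
move=> fi gi fg; rewrite -subr_ge0 -RintegralB//.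
have mgf : measurable_fun I01 (fun x => g x - f x).
  by apply: measurable_funB; apply/measurable_EFinP;
    [case/integrableP: gi|case/integrableP: fi].
rewrite (_ : Rintegral _ _ _ = \int[mu]_(x in I01) Num.max (g x - f x) 0).
  by apply: Rintegral_ge0 => x _; rewrite le_max lexx orbT.
congr fine; apply: ae_eq_integral => //.
- exact/measurable_EFinP.
- by apply/measurable_EFinP; exact: measurable_maxr.
- by apply: (ae01_sub _ fg) => x _ fgx /=; congr EFin; rewrite max_l// subr_ge0.
Qed.

Lemma ae_le_ip f1 g1 f2 g2 : L2 f1 -> L2 g1 -> L2 f2 -> L2 g2 ->
  ae01 (fun x => f1 x * g1 x <= f2 x * g2 x) -> ip f1 g1 <= ip f2 g2.
Proof. by move=> *; apply: ae_le_Rintegral => //; exact: L2M. Qed.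

End L2_space.
#[global] Hint Resolve L2_cst : core.
#[global] Hint Extern 0 (@measurable _ _ I01) => exact: measurable_I01 : core.

(** * Primitives of L^2 functions *)

Section primitive.
Context {R : realType}.
Implicit Types (f g h : R -> R) (a b x y : R).
Notation mu := (@lebesgue_measure R).

Definition prim f x : R := \int[mu]_(y in `[0, x]) f y.

Lemma itv0x_subset x : I01 x -> `[0, x] `<=` @I01 R.
Proof.
rewrite /I01 /= in_itv/= => /andP[x0 x1] y /=; rewrite !in_itv/= => /andP[-> yx].
exact: le_trans yx x1.
Qed.

Lemma L2_integrable0x f x : L2 f -> I01 x -> mu.-integrable `[0, x] (EFin \o f).
Proof.
move=> f2 Ix; apply: (@integrableS _ _ _ mu I01 `[0, x]) => //.
  exact: itv0x_subset.
exact: L2_integrable.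
Qed.

Lemma I010 : I01 (0 : R). Proof. by rewrite /I01/= in_itv/= lexx ler01. Qed.
Lemma I011 : I01 (1 : R). Proof. by rewrite /I01/= in_itv/= lexx ler01. Qed.
Hint Resolve I010 I011 : core.

Lemma primD f g x : L2 f -> L2 g -> I01 x -> prim (f + g) x = prim f x + prim g x.
Proof. by move=> f2 g2 Ix; rewrite -RintegralD//; exact: L2_integrable0x. Qed.

Lemma primZ a f x : L2 f -> I01 x -> prim (a *: f) x = a * prim f x.
Proof. by move=> f2 Ix; rewrite -RintegralZl//; exact: L2_integrable0x. Qed.

Lemma primN f x : L2 f -> I01 x -> prim (- f) x = - prim f x.
Proof. by move=> f2 Ix; rewrite -scaleN1r primZ// mulN1r. Qed.

Lemma prim0 f : prim f 0 = 0.
Proof. by rewrite /prim set_itv1 Rintegral_set1. Qed.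

Lemma prim1 f : prim f 1 = ip f (cst 1).
Proof. by apply: eq_Rintegral => x _; rewrite mulr1. Qed.

Lemma L2_norm f : L2 f -> L2 (fun x => `|f x|).
Proof.
move=> [mf f2]; split; first exact: measurableT_comp.
apply: (@eq_integrable _ _ _ mu I01 measurable_I01 (fun x => (f x ^+ 2)%:E)) => //.
by move=> x _; rewrite real_normK// num_real.
Qed.

Lemma L2norm_le_bound f (c : R) : (forall x, I01 x -> `|f x| <= c) -> L2 f ->
  L2norm f <= c.
Proof.
move=> fc f2; have c0 : 0 <= c by apply: le_trans (fc 0 _).
rewrite -ler_sqr ?nnegrE ?L2norm_ge0// sqr_L2norm expr2 -(ip_cst c c).
apply: le_Rintegral => //; [exact: L2M|exact: L2M|] => x /fc fxc /=.
rewrite -!expr2; rewrite -(real_normK (num_real (f x))) ler_sqr ?nnegrE//.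
Qed.

Lemma integrable_patch D f : measurable D -> mu.-integrable D (EFin \o f) ->
  mu.-integrable setT (EFin \o (f \_ D)).
Proof.
by move=> mD fi; rewrite -restrict_EFin; apply/integrable_restrict; rewrite ?setTI.
Qed.

(** Enlarge the domain of the integral of [|f|] to [0,1], then apply Cauchy-Schwarz against the
    constant 1. *)
Lemma prim_le f x : L2 f -> I01 x -> `|prim f x| <= L2norm f.
Proof.
move=> f2 Ix.
have af := L2_norm f2; have af' := L2_integrable0x f2 Ix.
apply: (le_trans (le_normr_Rintegral _ af')) => //.
apply: (@le_trans _ _ (\int[mu]_(x in I01) `|f x|)).
  rewrite [leLHS](_ : _ = \int[mu]_(y in I01 `&` `[0, x]) `|f y|); last first.
    by congr Rintegral; rewrite setIC; apply/esym/setIidPl/itv0x_subset.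
  rewrite Rintegral_mkcondr; apply: le_Rintegral => //.
  - apply: integrableS (integrable_patch (measurable_itv `[0, x]) _) => //.
    exact: L2_integrable0x.
  - exact: L2_integrable.
  - by move=> y _; rewrite patchE; case: ifP => // _; exact: normr_ge0.
rewrite [leLHS](_ : _ = ip (fun x => `|f x|) (cst 1)); last first.
  by apply: eq_Rintegral => y _; rewrite mulr1.
apply: (le_trans (ler_norm _)); apply: (le_trans (cauchy_schwarz_L2 af _)) => //.
rewrite L2norm_cst normr1 mulr1 [leLHS](_ : _ = L2norm f)//.
congr Num.sqrt; apply: eq_Rintegral => y _; by rewrite real_normK// num_real.
Qed.

Lemma L2_bounded f (c : R) : measurable_fun I01 f ->
  (forall x, I01 x -> `|f x| <= c) -> L2 f.
Proof.
move=> mf fc; split => //.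
apply: (@measurable_bounded_integrable _ _ _ mu (fun x => f x ^+ 2)) => //.
- by rewrite [X in (X < _)%E]lebesgue_I01 ltry.
- exact: measurable_funX.
- exists (c ^+ 2); split; first exact: num_real.
  move=> y cy x /fc fxc; apply: le_trans (ltW cy).
  by rewrite normrX lerXn2r ?nnegrE// (le_trans _ fxc).
Qed.

Lemma L2_prim f : L2 f -> L2 (prim f).
Proof.
move=> f2; apply: (@L2_bounded _ (L2norm f)) => [|x Ix]; last exact: prim_le.
apply: subspace_continuous_measurable_fun => //.
exact: (parameterized_integral_continuous ler01 (L2_integrable f2)).
Qed.

Lemma L2norm_prim f : L2 f -> L2norm (prim f) <= L2norm f.
Proof.
by move=> f2; apply: L2norm_le_bound => [x Ix|]; [exact: prim_le|exact: L2_prim].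
Qed.

Lemma H1_prim f : L2 f -> H1 (prim f) f.
Proof.
by move=> f2; split; [exact: L2_prim|split=> // x Ix]; rewrite prim0 add0r.
Qed.

Lemma integral_EFin D f : measurable D -> mu.-integrable D (EFin \o f) ->
  (\int[mu]_(x in D) (f x)%:E)%E = (\int[mu]_(x in D) f x)%:E.
Proof. by move=> mD fi; rewrite /Rintegral fineK//; exact: integrable_fin_num. Qed.

End primitive.
#[global] Hint Resolve I010 I011 : core.

(** * Fubini on a triangle *)

Section fubini.
Context {R : realType}.
Implicit Types (f g h : R -> R) (a b x y : R).
Notation mu := (@lebesgue_measure R).

(** Zero extensions and the 0-1 factor of the triangle [z.2 <= z.1] make Fubini applicable on the
    whole plane. *)
Let k f g (z : R * R) : R :=
  (f \_ I01) z.1 * (g \_ I01) z.2 * (z.2 <= z.1)%R%:R.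

(** Dropping the triangle factor can only increase the absolute value, and the iterated integral of
    [|f(x) g(y)|] factorises. *)
Let integrable_k f g : L2 f -> L2 g ->
  (mu \x mu)%E.-integrable setT (EFin \o k f g).
Proof.
move=> f2 g2.
have mf : measurable_fun setT (f \_ I01).
  by apply/(measurable_restrictT _ measurable_I01); case: f2.
have mg : measurable_fun setT (g \_ I01).
  by apply/(measurable_restrictT _ measurable_I01); case: g2.
have gi := integrable_patch measurable_I01 (L2_integrable g2).
have fi := integrable_patch measurable_I01 (L2_integrable f2).
pose F (z : R * R) := ((f \_ I01) z.1 * (g \_ I01) z.2).
have mF : measurable_fun setT F.
  by apply: measurable_funM; apply: measurableT_comp.
apply: (@le_integrable _ _ _ (mu \x mu)%E setT _ _ (EFin \o F)) => //.
- apply/measurable_EFinP; apply: measurable_funM => //.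
  rewrite (_ : (fun z => _) = \1_[set z : R * R | z.2 <= z.1]); last first.
    apply/funext => z; rewrite indicE.
    by have [h|h] := boolP (z.2 <= z.1); [rewrite mem_set|rewrite memNset//; exact/negP].
  apply: measurable_indic.
  rewrite (_ : [set _ | _] =
      [set: R * R] `&` (fun z : R * R => z.2 <= z.1) @^-1` [set true]).
    by apply: measurable_fun_ler => //.
  by rewrite setTI; apply/seteqP; split => z.
- move=> z _ /=; rewrite lee_fin /k normrM ler_piMr//.
  by case: (z.2 <= z.1)%R; rewrite ?normr1 ?normr0 ?ler01 ?lexx.
- have mF' : measurable_fun setT (EFin \o F) by exact/measurable_EFinP.
  have [_] := integrable12ltyP mu mu mF'; apply.
  rewrite /F /=.
  have H x : (\int[mu]_y (`|(f \_ I01) x * (g \_ I01) y|%:E))%E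
     = ((\int[mu]_y `|(g \_ I01) y|) * `|(f \_ I01) x|)%:E.
    rewrite integral_EFin//; last first.
      apply: (@integrable_norm _ _ _ mu _ (fun y => (f \_ I01) x * (g \_ I01) y)).
      exact: (@integrableZl _ _ _ mu _ _ ((f \_ I01) x) (EFin \o (g \_ I01))).
    congr EFin; rewrite mulrC -RintegralZl//; last first.
      exact: (@integrable_norm _ _ _ mu _ (g \_ I01)).
    by apply: eq_Rintegral => y _; rewrite normrM.
  under eq_integral do rewrite H.
  rewrite integral_EFin ?ltry//.
  apply: (@integrableZl _ _ _ mu _ _ (\int[mu]_y `|(g \_ I01) y|)
    (EFin \o (fun x => `|(f \_ I01) x|))) => //.
  exact: (@integrable_norm _ _ _ mu _ (f \_ I01)).
Qed.

(* Fubini for [f x * g y] on the triangle [y <= x] *)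
Lemma ip_prim f g : L2 f -> L2 g ->
  ip f (prim g) + ip (prim f) g = prim f 1 * prim g 1.
Proof.
move=> f2 g2.
have E1 x : (\int[mu]_y (k f g (x, y))%:E)%E = (((fun x => f x * prim g x) \_ I01) x)%:E.
  rewrite patchE; case: ifPn => Ix; last first.
    rewrite -[RHS](integral0 mu setT); apply: eq_integral => y _.
    by rewrite /k /= patchE (negbTE Ix) !mul0r.
  have {}Ix : I01 x by rewrite inE in Ix.
  have gi := integrable_patch (measurable_itv `[0, x]) (L2_integrable0x g2 Ix).
  transitivity (\int[mu]_y (f x * (g \_ `[0, x]) y)%:E)%E.
    apply: eq_integral => y _; congr EFin; rewrite /k /= patchE mem_set// -mulrA.
    congr (_ * _); rewrite !patchE.
    move: Ix; rewrite /I01 /= !mem_setE !in_itv /= => /andP[x0 x1].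
    have [y0/=|] := boolP (0 <= y); last by rewrite mul0r.
    have [yx|xy] := leP y x; last by rewrite mulr0.
    by rewrite (le_trans yx x1) mulr1.
  rewrite integral_EFin//; last first.
    exact: (@integrableZl _ _ _ mu _ _ (f x) (EFin \o (g \_ `[0, x]))).
  by congr EFin; rewrite RintegralZl// /prim [in RHS]Rintegral_mkcond.
(* For fixed [y] the variable [x] runs over [[y, 1]], so the inner integral is [prim f 1 - prim f y]
   times [g y]. *)
have E2 y : (\int[mu]_x (k f g (x, y))%:E)%E =
    (((fun y => prim f 1 * g y - prim f y * g y) \_ I01) y)%:E.
  rewrite patchE; case: ifPn => Iy; last first.
    rewrite -[RHS](integral0 mu setT); apply: eq_integral => x _.
    by rewrite /k /= [in X in _ * X * _]patchE (negbTE Iy) mulr0 mul0r.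
  have {}Iy : I01 y by rewrite inE in Iy.
  have y1 : `[y, 1] `<=` @I01 R.
    move: Iy; rewrite /I01/= in_itv/= => /andP[y0 _] x /=; rewrite !in_itv/=.
    by move=> /andP[yx ->]; rewrite (le_trans y0 yx).
  have fy1 : mu.-integrable `[y, 1] (EFin \o f) by apply: integrableS (L2_integrable f2).
  have fi := integrable_patch (measurable_itv `[y, 1]) fy1.
  transitivity (\int[mu]_x (g y * (f \_ `[y, 1]) x)%:E)%E.
    apply: eq_integral => x _; congr EFin; rewrite /k /= [X in _ * X * _]patchE mem_set//.
    rewrite mulrAC mulrC; congr (_ * _); rewrite !patchE.
    move: Iy; rewrite /I01 /= !mem_setE !in_itv /= => /andP[y0 _].
    have [x1/=|] := boolP (x <= 1); last by rewrite !andbF mul0r.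
    rewrite !andbT.
    have [yx|xy] := leP y x; last by rewrite mulr0.
    by rewrite (le_trans y0 yx) mulr1.
  rewrite integral_EFin//; last first.
    exact: (@integrableZl _ _ _ mu _ _ (g y) (EFin \o (f \_ `[y, 1]))).
  congr EFin; rewrite RintegralZl// -Rintegral_mkcond -mulrBl mulrC; congr (_ * _).
  rewrite /prim Rintegral_itvB//; [|exact: L2_integrable|..].
  - rewrite Rintegral_itv_obnd_cbnd//; apply: integrableS fy1 => //.
    by apply: subset_itvr; rewrite bnd_simp.
  - by move: Iy; rewrite /I01/= in_itv/= => /andP[]; rewrite bnd_simp.
  - by move: Iy; rewrite /I01/= in_itv/= => /andP[]; rewrite bnd_simp.
have : (\int[mu]_x \int[mu]_y (k f g (x, y))%:E = \int[mu]_y \int[mu]_x (k f g (x, y))%:E)%E.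
  exact: Fubini (integrable_k f2 g2).
under eq_integral do rewrite E1.
under [in RHS]eq_integral do rewrite E2.
have pf := L2_prim f2; have pg := L2_prim g2.
move=> /(congr1 fine); rewrite -/(Rintegral _ _ _) -/(Rintegral _ _ (_ \_ _)).
rewrite -!Rintegral_mkcond RintegralB//; last 2 first.
- exact: (@integrableZl _ _ _ mu _ _ (prim f 1) (EFin \o g) (L2_integrable g2)).
- exact: L2M.
rewrite RintegralZl//; last exact: L2_integrable.
by rewrite /ip => ->; rewrite subrK.
Qed.

End fubini.

(** * H^1(0,1): integration by parts, embedding, uniqueness of weak derivatives *)

Section H1_space.
Context {R : realType}.
Implicit Types (f g h : R -> R) (a b x y : R).
Notation mu := (@lebesgue_measure R).

Lemma eq_ipl f g h : (forall x, I01 x -> f x = g x) -> ip f h = ip g h.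
Proof. by move=> fg; apply: eq_Rintegral => x; rewrite inE => /fg ->. Qed.

Lemma eq_L2norm f g : (forall x, I01 x -> f x = g x) -> L2norm f = L2norm g.
Proof.
by move=> fg; congr Num.sqrt; apply: eq_Rintegral => x; rewrite inE => /fg ->.
Qed.

Lemma L2norm_ae f g : L2 f -> L2 g -> ae01 (fun x => f x = g x) ->
  L2norm f = L2norm g.
Proof.
move=> f2 g2 fg; rewrite /L2norm -!ip_L2norm2; congr Num.sqrt.
by rewrite (ip_ae f2 g2 f2 fg) ipC; exact: ip_ae.
Qed.

Lemma H1_L2 f f' : H1 f f' -> L2 f. Proof. by case. Qed.
Lemma H1_L2' f f' : H1 f f' -> L2 f'. Proof. by case=> _ []. Qed.

Lemma H1E f f' x : H1 f f' -> I01 x -> f x = f 0 + prim f' x.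
Proof. by move=> [_ [_ +]] Ix => /(_ _ Ix). Qed.

Lemma H1B f f' g g' : H1 f f' -> H1 g g' -> H1 (f - g) (f' - g').
Proof.
move=> Hf Hg; have [f2 [f'2 _]] := Hf; have [g2 [g'2 _]] := Hg.
split; [exact: L2B|split=> [|x Ix]; first exact: L2B].
rewrite -/(prim _ _) primD//; last exact: L2N.
by rewrite primN// !fctE (H1E Hf Ix) (H1E Hg Ix); ring.
Qed.

(** Each factor is its value at 0 plus a primitive; after this splitting, [ip_prim] settles the
    pairing of the two primitives. *)
Lemma H1_ibp f f' g g' : H1 f f' -> H1 g g' ->
  ip f g' + ip f' g = f 1 * g 1 - f 0 * g 0.
Proof.
move=> Hf Hg; have [f2 [f'2 _]] := Hf; have [g2 [g'2 _]] := Hg.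
have pf := L2_prim f'2; have pg := L2_prim g'2.
have E (h h' k : R -> R) : H1 h h' -> L2 k ->
    ip h k = h 0 * prim k 1 + ip (prim h') k.
  move=> Hh k2; have [_ [h'2 _]] := Hh.
  rewrite (@eq_ipl _ (h 0 *: cst 1 + prim h')); last first.
    by move=> x Ix; rewrite (H1E Hh Ix) fctE; congr (_ + _); exact: esym (mulr1 _).
  rewrite ipDl ?ipZl//; [|exact: L2Z|exact: L2_prim].
  by rewrite (ipC (cst 1)) prim1.
rewrite (E _ _ _ Hf g'2) (ipC f') (E _ _ _ Hg f'2).
have := ip_prim f'2 g'2; rewrite (ipC f').
by rewrite (H1E Hf I011) (H1E Hg I011); lra.
Qed.

(** One-dimensional Sobolev embedding. The number [f 0] is the value of the constant function
    [f - prim f'], so its modulus is an L^2 norm. *)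
Lemma H1_bound f f' x : H1 f f' -> I01 x -> `|f x| <= L2norm f + 2 * L2norm f'.
Proof.
move=> Hf Ix; have [f2 [f'2 _]] := Hf.
have f0 : `|f 0| <= L2norm f + L2norm f'.
  rewrite -L2norm_cst (@eq_L2norm _ (f - prim f')); last first.
    by move=> y Iy; change (f 0 = f y - prim f' y); rewrite (H1E Hf Iy) addrK.
  apply: (le_trans (L2normB f2 (L2_prim f'2))).
  by rewrite lerD2l L2norm_prim.
rewrite (H1E Hf Ix) (le_trans (ler_normD _ _))//.
by have := prim_le f'2 Ix; lra.
Qed.

(* Lebesgue differentiation *)
Lemma prim_eq0_ae f : L2 f -> (forall x, I01 x -> prim f x = 0) ->
  ae01 (fun x => f x = 0).
Proof.
move=> f2 pf0.
have fi := integrable_patch measurable_I01 (L2_integrable f2).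
(* [FTC1Ny] differentiates integrals from minus infinity, so the primitive of the zero extension is
   shown to vanish on the whole line. *)
have F0 x : \int[mu]_(t in `]-oo, x]) (f \_ I01) t = 0.
  rewrite -Rintegral_mkcondr.
  have [x0|x0] := ltP x 0.
    rewrite (_ : _ `&` _ = set0) ?Rintegral_set0//.
    rewrite -subset0 => y; rewrite /I01/= !in_itv/= => -[yx /andP[y0 _]].
    by have := le_lt_trans yx x0; rewrite ltNge y0.
  have [x1|x1] := leP x 1.
    rewrite (_ : _ `&` _ = [set` `[0, x]]); first by apply: pf0; rewrite /I01/= in_itv/= x0.
    apply/seteqP; split=> y; rewrite /I01/= !in_itv/=.
      by move=> [-> /andP[->]].
    by move=> /andP[-> yx]; rewrite yx (le_trans yx x1).
  rewrite (_ : _ `&` _ = [set` `[0, 1]]); first by apply: pf0.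
  apply/seteqP; split=> y; rewrite /I01/= !in_itv/=; first by case.
  by move=> /andP[-> y1]; rewrite y1 (le_trans y1 (ltW x1)).
have fy y : mu.-integrable `]-oo, y] (EFin \o (f \_ I01)).
  by apply: integrableS fi.
have := FTC1Ny fy (integrable_locally_restrict measurable_I01 (L2_integrable f2)).
rewrite (_ : (fun x => _) = cst 0); last exact/funext.
apply: filterS; first exact: (ae_filter_ringOfSetsType mu).
move=> x [_ +] Ix; rewrite derive1_cst patchE mem_set//.
Qed.

(** [H1] carries the weak derivative as a separate datum; this uniqueness identifies [px] and [mx]
    at time 0 with [p0x] and [m0x]. *)
Lemma H1_deriv_ae f f' g g' : H1 f f' -> H1 g g' ->
  (forall x, I01 x -> f x = g x) -> ae01 (fun x => f' x = g' x).
Proof.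
move=> Hf Hg fg; have [f2 [f'2 _]] := Hf; have [g2 [g'2 _]] := Hg.
apply: (@ae01_sub _ (fun x => (f' - g') x = 0)).
  by move=> x _ /eqP; rewrite fctE subr_eq0 => /eqP.
apply: prim_eq0_ae; first exact: L2B.
move=> x Ix; rewrite primD ?primN//; last exact: L2N.
by have := H1E Hf Ix; have := H1E Hg Ix; rewrite !fg//; lra.
Qed.

End H1_space.

(** * Derivatives in time and the product rule *)

Section time_derivatives.
Context {R : realType}.
Implicit Types (f g h : R -> R) (U W : R -> R -> R) (F : R -> R) (T t : R).

(** The filter stays inside [[0, T]], which makes the derivative one-sided at the two end times. *)
Definition deriv_within T F (l : R) t :=
  (s - t)^-1 * (F s - F t) @[s --> within (IT T) t^'] --> l.

Definition L2_deriv_within T U f t :=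
  L2norm ((s - t)^-1 *: (U s - U t) - f) @[s --> within (IT T) t^'] --> 0.

(** An interface common to [ip] and [ip0], so that continuity and the product rule are proved once
    for both. *)
Definition bounded_bilinear (B : (R -> R) -> (R -> R) -> R) (C : R) :=
  [/\ forall a f g h, L2 f -> L2 g -> L2 h ->
        B (a *: f + g) h = a * B f h + B g h,
      forall a f g h, L2 f -> L2 g -> L2 h ->
        B h (a *: f + g) = a * B h f + B h g &
      forall f g, L2 f -> L2 g -> `|B f g| <= C * (L2norm f * L2norm g)].

Lemma bounded_bilinear_cvg (X : Type) (D : set_system X) (FD : Filter D) B C
    (u w : X -> R -> R) f g :
  bounded_bilinear B C -> L2 f -> L2 g ->
  (\forall s \near D, L2 (u s)) -> (\forall s \near D, L2 (w s)) ->
  L2norm (u s - f) @[s --> D] --> 0 -> L2norm (w s - g) @[s --> D] --> 0 ->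
  B (u s) (w s) @[s --> D] --> B f g.
Proof.
move=> [Bl Br BC] f2 g2 u2 w2 uf wg.
(* [e s] majorises the three terms obtained by expanding [B (u s) (w s) - B f g] in [u s - f] and
   [w s - g]. *)
pose e s := C * (L2norm f * L2norm (w s - g) + L2norm (u s - f) * L2norm g +
  L2norm (u s - f) * L2norm (w s - g)).
have e0 : e s @[s --> D] --> C * (L2norm f * 0 + 0 * L2norm g + 0 * 0).
  by apply: cvgMr; apply: cvgD; [apply: cvgD; [exact: cvgMr|exact: cvgMl]|exact: cvgM].
rewrite mulr0 !mul0r !addr0 mulr0 in e0.
apply: (@squeeze_cvgr _ _ _ _ (fun s => B f g - e s) (fun s => B f g + e s)).
- near=> s; rewrite -ler_distl.
  have us : L2 (u s) by near: s.
  have ws : L2 (w s) by near: s.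
  have uf2 := L2B us f2; have wg2 := L2B ws g2.
  have -> : B (u s) (w s) = B f g + B f (w s - g) + B (u s - f) g +
      B (u s - f) (w s - g).
    have -> : B (u s) (w s) = B (u s - f) (w s) + B f (w s).
      by rewrite -[X in B X _ = _](subrK f) -[X in B (X + f) _]scale1r Bl// mul1r.
    have E h : L2 h -> B h (w s) = B h (w s - g) + B h g.
      move=> h2.
      by rewrite -[X in B _ X = _](subrK g) -[X in B _ (X + g)]scale1r Br// mul1r.
    by rewrite !E//; ring.
  rewrite [X in `|X|](_ : _ = B f (w s - g) + B (u s - f) g + B (u s - f) (w s - g));
    last by ring.
  rewrite /e !mulrDr (le_trans (ler_normD _ _))// lerD//; last exact: BC.
  by rewrite (le_trans (ler_normD _ _))// lerD//; exact: BC.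
- by rewrite -[X in _ --> X]subr0; apply: cvgB => //; exact: cvg_cst.
- by rewrite -[X in _ --> X]addr0; apply: cvgD => //; exact: cvg_cst.
Unshelve. all: by end_near. Qed.

Lemma L2norm0 : L2norm (0 : R -> R) = 0.
Proof. by have := L2norm_cst (0 : R); rewrite normr0. Qed.

Lemma near_IT_neq T t : \forall s \near within (IT T) t^', s != t.
Proof. apply: cvg_within; exact (nbhs_dnbhs_neq t). Qed.

(** The increment is [s - t] times a difference quotient whose norm stays bounded. *)
Lemma L2_deriv_within_cvg T U f t : L2 f -> (forall s, IT T s -> L2 (U s)) -> IT T t ->
  L2_deriv_within T U f t -> L2norm (U s - U t) @[s --> within (IT T) t^'] --> 0.
Proof.
move=> f2 U2 tT dU.
have ts : `|s - t| @[s --> within (IT T) t^'] --> (0 : R).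
  rewrite -[X in _ --> X](normr0 R) -(subrr t).
  apply: cvg_norm; apply: cvgB; last exact: cvg_cst.
  by apply: cvg_within_filter; apply: cvg_within.
apply: (@squeeze_cvgr _ _ _ _ (fun=> 0)
  (fun s => `|s - t| * (L2norm ((s - t)^-1 *: (U s - U t) - f) + L2norm f))).
- near=> s; rewrite L2norm_ge0/=.
  have us : L2 (U s) by apply: U2; near: s; exact: withinT.
  have st : s - t != 0.
    by rewrite subr_eq0; near: s; exact: near_IT_neq.
  have d2 : L2 (U s - U t) by apply: L2B => //; exact: U2.
  rewrite -[in leLHS](scale1r (U s - U t)) -(divff st) -scalerA L2normZ; last exact: L2Z.
  apply: ler_wpM2l => //; rewrite -[in leLHS](subrK f (_ *: _)).
  by apply: L2normD => //; apply: L2B => //; exact: L2Z.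
- exact: cvg_cst.
- rewrite -[X in _ --> X](mul0r (0 + L2norm f)); apply: cvgM => //.
  by apply: cvgD => //; exact: cvg_cst.
Unshelve. all: by end_near. Qed.

(** The difference quotient is that of [U] paired with [W s], plus [U t] paired with that of [W];
    both limits follow from the boundedness of [B]. *)
Lemma bounded_bilinear_deriv B C T U W f g t : bounded_bilinear B C ->
  (forall s, IT T s -> L2 (U s)) -> (forall s, IT T s -> L2 (W s)) ->
  L2 f -> L2 g -> IT T t -> L2_deriv_within T U f t -> L2_deriv_within T W g t ->
  deriv_within T (fun s => B (U s) (W s)) (B f (W t) + B (U t) g) t.
Proof.
move=> BC U2 W2 f2 g2 tT dU dW; have [Bl Br _] := BC.
have Ut := U2 _ tT; have Wt := W2 _ tT.
pose Q V s := (s - t)^-1 *: (V s - V t) : R -> R.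
have Q2 V : (forall s, IT T s -> L2 (V s)) ->
    \forall s \near within (IT T) t^', L2 (Q V s).
  move=> V2; near=> s; apply: L2Z; apply: L2B; apply: V2 => //.
  by near: s; exact: withinT.
have nL2 V : (forall s, IT T s -> L2 (V s)) ->
    \forall s \near within (IT T) t^', L2 (V s).
  by move=> V2; near=> s; apply: V2; near: s; exact: withinT.
have : B (Q U s) (W s) + B (U t) (Q W s) @[s --> within (IT T) t^'] -->
    B f (W t) + B (U t) g.
  apply: cvgD.
    apply: (bounded_bilinear_cvg _ BC) => //; [exact: Q2|exact: nL2|].
    exact: (L2_deriv_within_cvg g2).
  apply: (bounded_bilinear_cvg _ BC) => //; [by apply: nearW|exact: Q2|].
  rewrite (_ : (fun _ => _) = cst 0); first exact: cvg_cst.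
  by apply/funext => s; rewrite subrr L2norm0.
apply: cvg_trans; apply: near_eq_cvg; near=> s.
have Us : L2 (U s) by apply: U2; near: s; exact: withinT.
have Ws : L2 (W s) by apply: W2; near: s; exact: withinT.
have z2 : L2 (0 : R -> R) := L2_cst 0.
have BlZ a h k : L2 h -> L2 k -> B (a *: h) k = a * B h k.
  move=> h2 k2; have B0 : B 0 k = 0.
    by have := Bl 1 _ _ _ z2 z2 k2; rewrite scaler0 addr0; lra.
  by have := Bl a _ _ _ h2 z2 k2; rewrite addr0 B0 addr0.
have BrZ a h k : L2 h -> L2 k -> B k (a *: h) = a * B k h.
  move=> h2 k2; have B0 : B k 0 = 0.
    by have := Br 1 _ _ _ z2 z2 k2; rewrite scaler0 addr0; lra.
  by have := Br a _ _ _ h2 z2 k2; rewrite addr0 B0 addr0.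
rewrite /Q BlZ//; last exact: L2B.
rewrite BrZ//; last exact: L2B.
have -> : B (U s - U t) (W s) = B (U s) (W s) - B (U t) (W s).
  by rewrite addrC -scaleN1r Bl// mulN1r addrC.
have -> : B (U t) (W s - W t) = B (U t) (W s) - B (U t) (W t).
  by rewrite addrC -scaleN1r Br// mulN1r addrC.
ring.
Unshelve. all: by end_near. Qed.

Lemma deriv_withinD T F G (l k : R) t :
  deriv_within T F l t -> deriv_within T G k t ->
  deriv_within T (F \+ G) (l + k) t.
Proof.
move=> dF dG; rewrite /deriv_within; under eq_fun do rewrite opprD addrACA mulrDr.
exact: cvgD.
Qed.

Lemma deriv_withinZ T F (a l : R) t :
  deriv_within T F l t -> deriv_within T (fun s => a * F s) (a * l) t.
Proof.
move=> dF; rewrite /deriv_within; under eq_fun do rewrite -mulrBr mulrCA.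
exact: cvgMr.
Qed.

End time_derivatives.

(** * Gronwall's inequality on a closed time interval *)

Section gronwall.
Context {R : realType}.
Implicit Types (F : R -> R) (T t : R).

Lemma deriv_within_continuous T F (F' : R -> R) :
  (forall t, IT T t -> deriv_within T F (F' t) t) -> {within IT T, continuous F}.
Proof.
move=> dF; apply/subspace_continuousP => t tT.
have ts : s - t @[s --> within (IT T) t^'] --> (0 : R).
  rewrite -(subrr t); apply: cvgB; last exact: cvg_cst.
  by apply: cvg_within_filter; apply: cvg_within.
have H : F s @[s --> within (IT T) t^'] --> F t.
  have : F t + (s - t) * ((s - t)^-1 * (F s - F t)) @[s --> within (IT T) t^'] -->
      F t + 0 * F' t.
    by apply: cvgD; [exact: cvg_cst|apply: cvgM => //; exact: dF].
  rewrite mul0r addr0; apply: cvg_trans; apply: near_eq_cvg; near=> s.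
  rewrite mulVKf ?subrKC// subr_eq0; near: s; exact: near_IT_neq.
(* The limit [H] avoids [s = t]; continuity also has to cover that point, where the difference is
   zero. *)
apply/cvgrPdist_lt => e e0; move/cvgrPdist_lt/(_ e e0): H.
move=> K; have {}K : \forall s \near t, s != t -> IT T s -> `|F t - F s| < e := K.
change (\forall s \near t, IT T s -> `|F t - F s| < e).
near=> s => sT; have [->|st] := eqVneq s t; last by apply: (near K s).
by rewrite subrr normr0.
Unshelve. all: by end_near. Qed.

(** Near an interior time the constraint [IT T s] holds automatically; the rest is the substitution
    [s = h + t]. *)
Lemma deriv_within_is_derive T F (l : R) t :
  0 < t < T -> deriv_within T F l t -> is_derive t 1 F l.
Proof.
move=> /andP[t0 tT] dF.
have H : h^-1 *: ((F \o shift t) (h *: 1) - F t) @[h --> 0^'] --> l.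
  apply/cvgrPdist_lt => e e0; move/cvgrPdist_lt/(_ e e0): dF.
  move=> dF; have {}dF : \forall s \near t, s != t -> IT T s ->
    `|l - (s - t)^-1 * (F s - F t)| < e := dF.
  have tI : \forall s \near t, IT T s.
    near=> s; rewrite /IT/= in_itv/=; apply/andP; split.
      by apply: ltW; near: s; exact: lt_nbhsr.
    by apply: ltW; near: s; exact: lt_nbhsl.
  have : \forall s \near t, s != t -> `|l - (s - t)^-1 * (F s - F t)| < e.
    by near=> s => st; apply: (near dF s) => //; apply: (near tI s).
  rewrite (near_shift 0 t) => K.
  have {}K : (\forall z \near (0 : R), z + (t - 0) != t ->
      `|l - (z + (t - 0) - t)^-1 * (F (z + (t - 0)) - F t)| < e) := K.
  rewrite subr0 in K.
  change (\forall h \near (0 : R), h != 0 -> `|l - h^-1 *: ((F \o shift t) (h *: 1) - F t)| < e).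
  near=> h => h0.
  have : `|l - (h + t - t)^-1 * (F (h + t) - F t)| < e.
    apply: (near K h) => //.
    by apply: contra_neq h0 => ht; rewrite -(addrK t h) ht subrr.
  by rewrite addrK /shift /= [h *: 1]mulr1.
apply: DeriveDef; first by apply/cvg_ex; exists l.
exact: cvg_lim H.
Unshelve. all: by end_near. Qed.

(** [F t * expR (c * t)] has nonpositive derivative in the interior and is continuous up to the
    ends. The choice [c = 0] gives plain monotonicity. *)
Lemma gronwall T F (F' : R -> R) (c : R) :
  (forall t, IT T t -> deriv_within T F (F' t) t) ->
  (forall t, IT T t -> F' t <= - c * F t) ->
  forall t, IT T t -> F t <= F 0 * expR (- (c * t)).
Proof.
move=> dF F'le t tT.
pose G s := F s * expR (c * s).
have dG s : s \in `]0, T[ ->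
    is_derive s 1 G (F s * (expR (c * s) * c) + expR (c * s) * F' s).
  rewrite in_itv/= => /andP[s0 sT].
  have sI : IT T s by rewrite /IT/= in_itv/= !ltW.
  have dFs := deriv_within_is_derive (introT andP (conj s0 sT)) (dF _ sI).
  have dE : is_derive s 1 (fun s => expR (c * s)) (expR (c * s) * c).
    have dc : is_derive s 1 (fun s => c * s) c.
      by apply: is_derive_eq; rewrite /GRing.scale /= mulr1.
    exact: is_derive1_comp.
  by have := is_deriveM dFs dE.
have cG : {within `[0, T], continuous G}.
  move=> s; apply: cvgM; first exact: (deriv_within_continuous dF).
  apply: continuous_subspaceT => {}s.
  apply: continuous_comp; first exact: mulrl_continuous.
  exact: continuous_expR.
have t0 : 0 <= t <= T by move: tT; rewrite /IT/= in_itv/=.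
have : G t <= G 0.
  apply: (@ler0_derive1_le_cc _ G 0 T) => //.
  - by move=> s /dG [].
  - move=> s sT; rewrite derive1E; have [_ ->] := dG _ sT.
    have sI : IT T s by move: sT; rewrite /IT/= !in_itv/= => /andP[/ltW -> /ltW ->].
    have h := F'le _ sI; have e0 := expR_gt0 (c * s).
    rewrite (_ : _ + _ = expR (c * s) * (F' s + c * F s)); last by ring.
    by rewrite pmulr_rle0//; lra.
  - by rewrite in_itv/= lexx; case/andP: t0 => /le_trans; apply.
  - by case/andP: t0.
rewrite /G mulr0 expR0 mulr1 => h.
by rewrite expRN ler_pdivlMr ?expR_gt0.
Qed.

End gronwall.

(** * The bilinear forms of the energy argument *)

Section bilinear_forms.
Context {R : realType}.
Implicit Types (f g h : R -> R) (B : (R -> R) -> (R -> R) -> R) (C : R).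

(** A bounded form does not see null sets, because [f + g] has norm zero. The equation [qt = - vx],
    valid only almost everywhere, enters both forms in this way. *)
Lemma bounded_bilinear_aeN B C f g h : bounded_bilinear B C ->
  L2 f -> L2 g -> L2 h -> ae01 (fun x => f x = - g x) ->
  B f h = - B g h /\ B h f = - B h g.
Proof.
move=> [Bl Br BC] f2 g2 h2 fg.
have fg2 := L2D f2 g2.
have fg0 : L2norm (f + g) = 0.
  rewrite -(@L2norm0 R); apply: L2norm_ae => //; first exact: (L2_cst 0).
  by apply: ae01_sub fg => x _ fx; rewrite fctE fx addNr.
have := BC _ _ fg2 h2; have := BC _ _ h2 fg2; rewrite fg0 mulr0 mul0r mulr0 !normr_le0.
rewrite -{1 2}(scale1r f) Bl// Br// !mul1r => /eqP hr /eqP hl.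
by split; lra.
Qed.

Lemma bounded_bilinear_ip : bounded_bilinear (@ip R) 1.
Proof.
split=> [a f g h f2 g2 h2|a f g h f2 g2 h2|f g f2 g2].
- by rewrite ipDl ?ipZl//; exact: L2Z.
- by rewrite ipDr ?ipZr//; exact: L2Z.
- by rewrite mul1r; exact: cauchy_schwarz_L2.
Qed.

(* [f] paired with the mean-zero primitive of [g] *)
Definition ip0 f g := ip f (prim g) - ip f (cst 1) * ip (cst 1) (prim g).

(** The constant 2 counts the two terms of [ip0], each at most [L2norm f * L2norm g]. *)
Lemma bounded_bilinear_ip0 : bounded_bilinear ip0 2.
Proof.
split=> [a f g h f2 g2 h2|a f g h f2 g2 h2|f g f2 g2]; rewrite /ip0.
- have ph := L2_prim h2; have af := L2Z a f2.
  by rewrite !ipDl// !ipZl//; ring.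
- have E (k : R -> R) : L2 k -> ip k (prim (a *: f + g)) = a * ip k (prim f) + ip k (prim g).
    move=> k2; have pf := L2_prim f2; have pg := L2_prim g2.
    rewrite -ipZr// -ipDr//; last exact: L2Z.
    rewrite ipC [RHS]ipC; apply: eq_ipl => x Ix.
    by rewrite primD ?primZ//; exact: L2Z.
  by rewrite !E//; ring.
- have pg := L2_prim g2; have pgg := L2norm_prim g2.
  have f0 := L2norm_ge0 f; have p0 := L2norm_ge0 (prim g).
  have h1 := cauchy_schwarz_L2 f2 pg; have h2 := cauchy_schwarz_L2 f2 (L2_cst 1).
  have h3 := cauchy_schwarz_L2 (L2_cst 1) pg.
  rewrite L2norm_cst normr1 mulr1 in h2; rewrite L2norm_cst normr1 mul1r in h3.
  rewrite (le_trans (ler_normB _ _))// normrM.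
  have h4 := ler_pM (normr_ge0 _) (normr_ge0 _) h2 h3.
  have := ler_wpM2l f0 pgg; lra.
Qed.

End bilinear_forms.

(** * Energy estimates for a damped wave system *)

Section damped_wave.
Context {R : realType}.
Variables (T d0 D : R) (q v qx vx qt vt : R -> R -> R).
Hypothesis d0_gt0 : 0 < d0.
Hypothesis Hq : forall t, IT T t -> H1 (q t) (qx t).
Hypothesis Hv : forall t, IT T t -> H1 (v t) (vx t).
Hypothesis q_bnd : forall t, IT T t -> q t 0 = 0 /\ q t 1 = 0.
Hypothesis qt2 : forall t, IT T t -> L2 (qt t).
Hypothesis vt2 : forall t, IT T t -> L2 (vt t).
Hypothesis dq : forall t, IT T t -> L2_deriv_within T q (qt t) t.
Hypothesis dv : forall t, IT T t -> L2_deriv_within T v (vt t) t.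
Hypothesis mass : forall t, IT T t -> ae01 (fun x => qt t x = - vx t x).

(** Taking the damping as the residual of the momentum equation turns that equation into an identity
    of functions ([vtE]), places [r] in L^2 at once and keeps the section independent of [d]. *)
Let r t := - (vt t + qx t).
Hypothesis r_coer : forall t, IT T t ->
  ae01 (fun x => d0 * (v t x * v t x) <= r t x * v t x).

Let q2 t (tT : IT T t) : L2 (q t) := H1_L2 (Hq tT).
Let v2 t (tT : IT T t) : L2 (v t) := H1_L2 (Hv tT).
Let qx2 t (tT : IT T t) : L2 (qx t) := H1_L2' (Hq tT).
Let vx2 t (tT : IT T t) : L2 (vx t) := H1_L2' (Hv tT).
Let r2 t (tT : IT T t) : L2 (r t) := L2N (L2D (vt2 tT) (qx2 tT)).

Let vtE t : vt t = - qx t - r t.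
Proof. by rewrite /r opprK addrC addrK. Qed.

Let energy t := ip (q t) (q t) / 2 + ip (v t) (v t) / 2.

(** The pairings of [vx] with [q] and of [qx] with [v] add up to a boundary term, which is zero
    because [q] vanishes at both ends. *)
Let energy_deriv t : IT T t -> deriv_within T energy (- ip (r t) (v t)) t.
Proof.
move=> tT; have bb := @bounded_bilinear_ip R.
have Hq2 := bounded_bilinear_deriv bb q2 q2 (qt2 tT) (qt2 tT) tT (dq tT) (dq tT).
have Hv2 := bounded_bilinear_deriv bb v2 v2 (vt2 tT) (vt2 tT) tT (dv tT) (dv tT).
have := deriv_withinD (deriv_withinZ (a := 2^-1) Hq2) (deriv_withinZ (a := 2^-1) Hv2).
rewrite (ipC (q t)) (ipC (v t)).
have [-> _] := bounded_bilinear_aeN bb (qt2 tT) (vx2 tT) (q2 tT) (mass tT).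
have vv := v2 tT; have rr := r2 tT; have xx := qx2 tT.
rewrite vtE ipBl ?(ipNl xx vv)//; last exact: L2N.
have := H1_ibp (Hq tT) (Hv tT); have [-> ->] := q_bnd tT.
rewrite !mul0r subr0 ipC => ibp.
set a := (X in deriv_within _ _ X t); rewrite (_ : a = - ip (r t) (v t)); last by rewrite /a; lra.
by rewrite /energy; congr (deriv_within T _ _ t); apply/funext => s /=; rewrite !(mulrC 2^-1).
Qed.

Let r_coer_ip t : IT T t -> d0 * ip (v t) (v t) <= ip (r t) (v t).
Proof.
move=> tT; have vv := v2 tT; rewrite -ipZl//.
apply: ae_le_ip => //; [exact: L2Z|exact: r2|].
by apply: ae01_sub (r_coer tT) => x _; rewrite fctE -[_ *: _]/(_ * _) mulrA.
Qed.

(** Placed ahead of the Lipschitz hypothesis on [r], since the constant [D] is later obtained from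
    this monotonicity. *)
Lemma energy_nonincreasing t : IT T t -> energy t <= energy 0.
Proof.
move=> tT; have := gronwall (c := 0) energy_deriv _ tT.
rewrite mul0r oppr0 expR0 mulr1; apply=> s sT.
rewrite mul0r oppr_le0 (le_trans _ (r_coer_ip sT))//.
by rewrite mulr_ge0 ?ip_ge0 ?ltW.
Qed.

Hypothesis D_ge0 : 0 <= D.
Hypothesis r_lip : forall t, IT T t -> ae01 (fun x => `|r t x| <= D * `|v t x|).

(** Chosen to meet three demands: [eps <= 1 / 4] keeps the modified energy comparable to [energy];
    [eps * (2 * D ^+ 2 + 1) <= d0 / 2] lets half of the damping absorb the [v] terms of [X'];
    [eps <= d0 / 2] leaves enough of the other half for the decay of [v]. *)
Let eps := d0 / (2 * (2 * D ^+ 2 + 1) + 4 * d0).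

Let X t := ip0 (v t) (q t).
Let X' t := ip (q t) (q t) - ip0 (r t) (q t) - ip (v t) (v t) + ip (v t) (cst 1) ^+ 2.

(** Since [q] vanishes at both ends, [qx] has mean zero and its pairing with the primitive of [q] is
    [- ip (q t) (q t)] by parts. The primitive of [vx] is [v] minus the constant [v t 0], and the
    mean-zero form cancels this constant. *)
Let X_deriv t : IT T t -> deriv_within T X (X' t) t.
Proof.
move=> tT; have bb := @bounded_bilinear_ip0 R.
have := bounded_bilinear_deriv bb v2 q2 (vt2 tT) (qt2 tT) tT (dv tT) (dq tT).
have [_ ->] := bounded_bilinear_aeN bb (qt2 tT) (vx2 tT) (v2 tT) (mass tT).
have [Bl _ _] := bb; have qq := q2 tT; have vv := v2 tT; have rr := r2 tT.
have qqx := qx2 tT; have vvx := vx2 tT; have pq := L2_prim qq; have pvx := L2_prim vvx.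
have [q0 q1] := q_bnd tT.
rewrite vtE -opprD -scaleN1r -[_ *: _]addr0 Bl//; [|exact: L2D|exact: (L2_cst 0)].
rewrite -{1}(scale1r (qx t)) Bl// mul1r.
have -> : ip0 0 (q t) = 0.
  have z2 : L2 (0 : R -> R) := L2_cst 0.
  by have := Bl 1 _ _ _ z2 z2 qq; rewrite scaler0 addr0; lra.
have -> : ip0 (qx t) (q t) = - ip (q t) (q t).
  rewrite /ip0 -prim1.
  have -> : prim (qx t) 1 = 0 by have := H1E (Hq tT) I011; rewrite q0 q1; lra.
  by have := H1_ibp (Hq tT) (H1_prim qq); rewrite q0 q1; lra.
have -> : ip0 (v t) (vx t) = ip (v t) (v t) - ip (v t) (cst 1) ^+ 2.
  have E h : L2 h -> ip h (prim (vx t)) = ip h (v t) - v t 0 * ip h (cst 1).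
    move=> h2; rewrite -ipZr// -ipBr//; last exact: L2Z.
    rewrite ipC [RHS]ipC; apply: eq_ipl => x Ix.
    rewrite !fctE (H1E (Hv tT) Ix) -[_ *: _]/(_ * _) mulr1; ring.
  by rewrite /ip0 !E// ip_cst (ipC (cst 1)); ring.
by congr (deriv_within T _ _ t); rewrite /X'; ring.
Qed.

Let r_le t : IT T t -> L2norm (r t) <= D * L2norm (v t).
Proof.
move=> tT; have rr := r2 tT; have vv := v2 tT.
rewrite -[D in leRHS](ger0_norm D_ge0) -L2normZ//.
have Dv := L2Z D vv.
rewrite -ler_sqr ?nnegrE ?L2norm_ge0// !sqr_L2norm; apply: ae_le_ip => //.
apply: ae01_sub (r_lip tT) => x _ rv; rewrite !fctE -[_ *: _]/(_ * _) -!expr2.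
rewrite -[leLHS]real_normK ?num_real// -[leRHS]real_normK ?num_real//.
by rewrite lerXn2r ?nnegrE// normrM (ger0_norm D_ge0).
Qed.

Lemma energy_decay t : IT T t ->
  energy t <= 3 * energy 0 * expR (- (eps / 2 * t)).
Proof.
move=> tT; have D2 : 0 <= D ^+ 2 by exact: sqr_ge0. have d00 := d0_gt0; have D0 := D_ge0.
have den : 0 < 2 * (2 * D ^+ 2 + 1) + 4 * d0 by lra.
have eps0 : 0 < eps by rewrite divr_gt0.
have epsE : eps * (2 * (2 * D ^+ 2 + 1) + 4 * d0) = d0 by rewrite divfK// gt_eqF.
have epsd : 0 <= eps * d0 by rewrite mulr_ge0// ltW.
have epsD : 0 <= eps * D ^+ 2 by rewrite mulr_ge0// ltW.
have eps4 : eps <= 1 / 4 by rewrite ler_pdivrMr//; lra.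
have eps1 : eps * (2 * D ^+ 2 + 1) <= d0 / 2 by lra.
have eps2 : eps <= d0 / 2 by lra.
pose F s := energy s + (- eps) * X s.
(* Hence [F] lies between 1/2 and 3/2 of the energy; the factor 3 of the statement is the ratio of
   these two constants. *)
have XE s : IT T s -> `|eps * X s| <= energy s / 2.
  move=> sT; have [_ _ BC] := @bounded_bilinear_ip0 R.
  have := BC _ _ (v2 sT) (q2 sT); rewrite /energy -!sqr_L2norm -/(X s) => h.
  have := L2norm_ge0 (v s); have := L2norm_ge0 (q s).
  move: h; move: (L2norm (q s)) (L2norm (v s)) => a b h a0 b0.
  rewrite normrM (gtr0_norm eps0).
  have : eps * `|X s| <= 1 / 4 * `|X s| by apply: ler_wpM2r.
  by have := sqr_ge0 (a - b); nra.
have dF s : IT T s -> deriv_within T F (- ip (r s) (v s) + - eps * X' s) s.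
  by move=> sT; apply: deriv_withinD; [exact: energy_deriv|apply: deriv_withinZ; exact: X_deriv].
(* The left side is at most [- eps * energy s], while [F s] is at most 3/2 of the energy, so the
   rate [eps / 2] suffices. *)
have F'le s : IT T s -> - ip (r s) (v s) + - eps * X' s <= - (eps / 2) * F s.
  move=> sT; have [_ _ BC] := @bounded_bilinear_ip0 R.
  have h1 := r_coer_ip sT; have h2 := le_trans (ler_norm _) (BC _ _ (r2 sT) (q2 sT)).
  have h3 := r_le sT; have h4 := XE _ sT; have h5 := sqr_ge0 (ip (v s) (cst 1)).
  have a0 := L2norm_ge0 (q s); have b0 := L2norm_ge0 (v s).
  rewrite /F /X'; move: h4; rewrite ler_norml => /andP[h4 _].
  rewrite /energy in h4 *; rewrite -!sqr_L2norm in h1 h4 *.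
  have h6 : ip0 (r s) (q s) <= 2 * (D * L2norm (v s) * L2norm (q s)).
    by rewrite (le_trans h2)// ler_pM2l// ler_wpM2r.
  move: h1 h4 h5 h6 a0 b0; move: (L2norm (q s)) (L2norm (v s)) => a b.
  move: (ip0 _ _) (ip (v s) _ ^+ 2) (ip _ _) (X s) => z m y x h1 h4 m0 h6 a0 b0.
  (* Young's inequality, weighted so that half of the gain [a ^+ 2] survives. *)
  have h7 : z <= a ^+ 2 / 2 + 2 * D ^+ 2 * b ^+ 2.
    by have := sqr_ge0 (a - 2 * D * b); nra.
  (* The squared mean [m] is nonnegative and is discarded here. *)
  have h8 : eps * (a ^+ 2 / 2 - (2 * D ^+ 2 + 1) * b ^+ 2) <=
      eps * (a ^+ 2 - z - b ^+ 2 + m).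
    by rewrite ler_pM2l//; lra.
  have b20 := sqr_ge0 b; have a20 := sqr_ge0 a.
  have h9 := ler_wpM2r b20 eps1; have h10 := ler_wpM2r b20 eps2.
  have h11 : eps * (- (eps * x)) <= eps * ((a ^+ 2 / 2 + b ^+ 2 / 2) / 2).
    by rewrite ler_pM2l//; lra.
  nra.
have t0 : 0 <= t <= T by move: tT; rewrite /IT/= in_itv/=.
have zT : IT T 0 by rewrite /IT/= in_itv/= lexx; case/andP: t0 => /le_trans; apply.
have := gronwall dF F'le tT; rewrite /F.
have := XE _ tT; have := XE _ zT; rewrite !ler_norml => /andP[h1 _] /andP[_ h2] h3.
have e0 := expR_gt0 (- (eps / 2 * t)).
have : (energy 0 + - eps * X 0) * expR (- (eps / 2 * t)) <=
    (energy 0 * (3 / 2)) * expR (- (eps / 2 * t)).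
  by rewrite ler_pM2r//; lra.
lra.
Qed.

End damped_wave.

(** * Elementary facts on energies and norms *)

Section energy_facts.
Context {R : realType}.
Implicit Types (f g : R -> R).

Lemma E_L2norm f g : E f g = L2norm f ^+ 2 / 2 + L2norm g ^+ 2 / 2.
Proof. by rewrite !sqr_L2norm. Qed.

Lemma E_ip f g : E f g = ip f f / 2 + ip g g / 2.
Proof. by []. Qed.

Lemma eq_E f f' g g' : (forall x, I01 x -> f x = f' x) ->
  (forall x, I01 x -> g x = g' x) -> E f g = E f' g'.
Proof. by move=> ff' gg'; rewrite !E_L2norm (eq_L2norm ff') (eq_L2norm gg'). Qed.

Lemma E_scale (a : R) f g : L2 f -> L2 g -> E (a *: f) (a *: g) = a ^+ 2 * E f g.
Proof.
move=> f2 g2; rewrite !E_L2norm !L2normZ// !exprMn real_normK ?num_real//; ring.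
Qed.

Lemma E_le f g (a b : R) : L2norm f <= a -> L2norm g <= b ->
  E f g <= (a ^+ 2 + b ^+ 2) / 2.
Proof.
move=> fa gb; rewrite E_L2norm -mulrDl ler_pM2r ?invr_gt0//.
have a0 := le_trans (L2norm_ge0 f) fa; have b0 := le_trans (L2norm_ge0 g) gb.
by apply: lerD; rewrite lerXn2r ?nnegrE ?L2norm_ge0.
Qed.

Lemma L2norm_Esqrt f g (e : R) : E f g <= e ->
  L2norm f <= Num.sqrt (2 * e) /\ L2norm g <= Num.sqrt (2 * e).
Proof.
rewrite E_L2norm => fge; have f0 := sqr_ge0 (L2norm f); have g0 := sqr_ge0 (L2norm g).
split; rewrite -[leLHS]ger0_norm ?L2norm_ge0// -sqrtr_sqr ler_wsqrtr//; lra.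
Qed.

Lemma L2norm_le_ae f (c : R) : 0 <= c -> ae01 (fun x => `|f x| <= c) -> L2 f ->
  L2norm f <= c.
Proof.
move=> c0 fc f2; rewrite -[leRHS]ger0_norm// -L2norm_cst.
rewrite -ler_sqr ?nnegrE ?L2norm_ge0// !sqr_L2norm; apply: ae_le_ip => //.
apply: ae01_sub fc => x _ fxc /=; rewrite -!expr2 -(real_normK (num_real (f x))).
by rewrite lerXn2r ?nnegrE.
Qed.

Lemma H1norm_ge f f' : L2norm f <= H1norm f f' /\ L2norm f' <= H1norm f f'.
Proof.
have f0 : 0 <= L2norm2 f := ip_ge0 f; have f'0 : 0 <= L2norm2 f' := ip_ge0 f'.
by split; rewrite ler_wsqrtr// ?lerDl ?lerDr.
Qed.

End energy_facts.

(** * Coercivity and local Lipschitz continuity of the damping *)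

Section damping.
Context {R : realType}.
Variables (d : R -> R) (d0 d1 d2 pw : R).
Hypotheses (d0_gt0 : 0 < d0) (d1_ge0 : 0 <= d1) (d2_ge0 : 0 <= d2) (pw_ge0 : 0 <= pw).
Hypothesis d_der : forall x, derivable d x 1.
Hypothesis d'_gt : forall x, @derive1 R R d x > d0.
Hypothesis d'_le : forall x, `|@derive1 R R d x| <= d1 + d2 * (`|x| `^ pw).

Definition dLip (M : R) := d1 + d2 * (M `^ pw).

Lemma dLip_ge0 M : 0 <= dLip M.
Proof. by rewrite addr_ge0// mulr_ge0// powR_ge0. Qed.

(** Mean value theorem. The location of [c] is recorded because the bound on the derivative of [d]
    grows with its argument. *)
Lemma damping_mvt a b : exists2 c, `|c| <= Num.max `|a| `|b| &
  d a - d b = @derive1 R R d c * (a - b).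
Proof.
wlog ba : a b / b <= a => [H|].
  have [/H//|/ltW/H [c cab E]] := leP b a.
  by exists c; [rewrite maxC|rewrite -opprB E; ring].
have [c cab ->] : exists2 c, c \in `[b, a] & d a - d b = @derive1 R R d c * (a - b).
  apply: MVT_segment => // [x _|]; first by rewrite derive1E; exact/derivableP.
  apply: continuous_subspaceT => x.
  exact/differentiable_continuous/derivable1_diffP.
exists c => //; move: cab; rewrite in_itv/= => /andP[bc ca].
rewrite le_max; have [c0|c0] := leP 0 c.
  by rewrite ger0_norm// (le_trans ca (ler_norm a)).
by rewrite ltr0_norm// orbC -normrN (le_trans _ (ler_norm _))// lerN2.
Qed.

Lemma damping_coercive a b : d0 * ((a - b) * (a - b)) <= (d a - d b) * (a - b).
Proof.
have [c _ ->] := damping_mvt a b.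
by rewrite -mulrA ler_wpM2r -?expr2 ?sqr_ge0// ltW.
Qed.

Lemma damping_lipschitz M a b : `|a| <= M -> `|b| <= M ->
  `|d a - d b| <= dLip M * `|a - b|.
Proof.
move=> aM bM; have [c cab ->] := damping_mvt a b.
rewrite normrM ler_wpM2r// (le_trans (d'_le c))// lerD2l ler_wpM2l//.
have cM : `|c| <= M by rewrite (le_trans cab)// ge_max aM bM.
by rewrite ge0_ler_powR ?nnegrE// (le_trans _ cM).
Qed.

End damping.

(** * Solutions as trajectories *)

Section trajectories.
Context {R : realType}.
Variables (d : R -> R) (fb gb : R -> R) (h0 h1 : R).
Implicit Types (T : R) (u p m px mx pt mt : R -> R -> R).

(** A solution notion without prescribed initial values: it is stable under forward shifts and
    restriction in time, and it contains the steady states as constant trajectories. *)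
Definition trajectory T p m px mx pt mt :=
  [/\ forall t, IT T t -> H1 (p^~ t) (px^~ t) /\ H1 (m^~ t) (mx^~ t),
      forall t, IT T t -> L2 (pt^~ t) /\ L2 (mt^~ t),
      deriv_L2 T p pt /\ deriv_L2 T m mt,
      forall t, IT T t -> ae01 (fun x =>
        pt x t + mx x t = fb x /\ mt x t + px x t + d (m x t) = gb x) &
      forall t, IT T t -> p 0 t = h0 /\ p 1 t = h1].

Lemma deriv_L2_quotient (u ut : R -> R -> R) s t :
  L2norm2 (fun x => (u x s - u x t) / (s - t) - ut x t) =
  L2norm ((s - t)^-1 *: (u^~ s - u^~ t) - ut^~ t) ^+ 2.
Proof.
rewrite sqr_L2norm; apply: eq_Rintegral => x _.
by rewrite !fctE -[_ *: _]/(_ * _) expr2 (mulrC (s - t)^-1).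
Qed.

Lemma deriv_L2_within T u (ut : R -> R -> R) t : deriv_L2 T u ut -> IT T t ->
  L2_deriv_within T (fun s => u^~ s) (ut^~ t) t.
Proof.
move=> du tT; apply/cvgrPdist_lt => e e0.
(* [deriv_L2] measures the squared norm, hence the tolerance [e ^+ 2]. *)
have e20 : 0 < e ^+ 2 by rewrite exprn_gt0.
have [del del0 H] := du _ tT _ e20.
change (\forall s \near t, s != t -> IT T s ->
  `|0 - L2norm ((s - t)^-1 *: (u^~ s - u^~ t) - ut^~ t)| < e).
near=> s => st sT.
rewrite sub0r normrN ger0_norm ?L2norm_ge0//.
rewrite -ltr_sqr ?nnegrE ?L2norm_ge0 ?(ltW e0)// -deriv_L2_quotient.
apply: H => //; rewrite normr_gt0 subr_eq0 st/= distrC.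
by near: s; exact: nbhsx_ballx.
Unshelve. all: by end_near. Qed.

Lemma L2_deriv_withinB T (U W : R -> R -> R) (f g : R -> R) t :
  (forall s, IT T s -> L2 (U s)) -> (forall s, IT T s -> L2 (W s)) ->
  L2 f -> L2 g -> IT T t -> L2_deriv_within T U f t -> L2_deriv_within T W g t ->
  L2_deriv_within T (fun s => U s - W s) (f - g) t.
Proof.
move=> U2 W2 f2 g2 tT dU dW.
have := cvgD dU dW; rewrite addr0 => dUW.
apply: (@squeeze_cvgr _ _ _ _ (fun=> 0)
  (fun s => L2norm ((s - t)^-1 *: (U s - U t) - f) +
            L2norm ((s - t)^-1 *: (W s - W t) - g))); [|exact: cvg_cst|exact: dUW].
near=> s; rewrite L2norm_ge0/=.
have sT : IT T s by near: s; exact: withinT.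
have -> : (s - t)^-1 *: (U s - W s - (U t - W t)) - (f - g) =
    ((s - t)^-1 *: (U s - U t) - f) - ((s - t)^-1 *: (W s - W t) - g).
  by apply/funext => x; rewrite !fctE -![_ *: _]/(_ * _); ring.
by apply: L2normB; apply: L2B => //; apply: L2Z; apply: L2B;
  [exact: U2|exact: U2|exact: W2|exact: W2].
Unshelve. all: by end_near. Qed.

End trajectories.

(** The rate [eps / 2] of [energy_decay], written out because [eps] is local to its section. *)
Definition decay_rate {R : realType} (d0 D : R) :=
  d0 / (2 * (2 * D ^+ 2 + 1) + 4 * d0) / 2.

(** * Comparison of trajectories and passage to time derivatives *)

Section trajectory_energy.
Context {R : realType}.
Variables (d : R -> R) (d0 d1 d2 pw : R).
Hypotheses (d0_gt0 : 0 < d0) (d1_ge0 : 0 <= d1) (d2_ge0 : 0 <= d2) (pw_ge0 : 0 <= pw).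
Hypothesis d_der : forall x, derivable d x 1.
Hypothesis d'_gt : forall x, @derive1 R R d x > d0.
Hypothesis d'_le : forall x, `|@derive1 R R d x| <= d1 + d2 * (`|x| `^ pw).
Variables (fb gb : R -> R) (h0 h1 : R).
Implicit Types (T S : R) (u p m px mx pt mt : R -> R -> R).

Let traj := trajectory d fb gb h0 h1.
Let L := dLip d1 d2 pw.

Lemma IT0 T t : IT T t -> IT T 0.
Proof.
by rewrite /IT/= !in_itv/= lexx => /andP[t0 tT]; exact: le_trans t0 tT.
Qed.

(** Used against the steady state and for a solution against its own shift. The conclusion has two
    parts because the bound [M] asked for in the second is reached through the first. *)
Lemma trajectory_diff T p m px mx pt mt p' m' px' mx' pt' mt' t :
  traj T p m px mx pt mt -> traj T p' m' px' mx' pt' mt' -> IT T t ->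
  let e s := E (p^~ s - p'^~ s) (m^~ s - m'^~ s) in
  e t <= e 0 /\
  forall M, (forall s x, IT T s -> I01 x -> `|m x s| <= M /\ `|m' x s| <= M) ->
    e t <= 3 * e 0 * expR (- (decay_rate d0 (L M) * t)).
Proof.
move=> [H H2 [dp dm] eqs bnd] [H' H2' [dp' dm'] eqs' bnd'] tT e.
pose q s := p^~ s - p'^~ s; pose qx s := px^~ s - px'^~ s; pose qt s := pt^~ s - pt'^~ s.
pose v s := m^~ s - m'^~ s; pose vx s := mx^~ s - mx'^~ s; pose vt s := mt^~ s - mt'^~ s.
have Hq s : IT T s -> H1 (q s) (qx s).
  by move=> sT; apply: H1B; [case: (H s sT)|case: (H' s sT)].
have Hv s : IT T s -> H1 (v s) (vx s).
  by move=> sT; apply: H1B; [case: (H s sT)|case: (H' s sT)].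
have q0 s : IT T s -> q s 0 = 0 /\ q s 1 = 0.
  move=> sT; rewrite /q !fctE; have [-> ->] := bnd _ sT; have [-> ->] := bnd' _ sT.
  by rewrite !subrr.
have qt2 s : IT T s -> L2 (qt s).
  by move=> sT; apply: L2B; [case: (H2 s sT)|case: (H2' s sT)].
have vt2 s : IT T s -> L2 (vt s).
  by move=> sT; apply: L2B; [case: (H2 s sT)|case: (H2' s sT)].
have dq s : IT T s -> L2_deriv_within T q (qt s) s.
  move=> sT; apply: L2_deriv_withinB => //; try exact: deriv_L2_within.
  - by move=> {sT} s sT; have [/H1_L2] := H s sT.
  - by move=> {sT} s sT; have [/H1_L2] := H' s sT.
  - by case: (H2 s sT).
  - by case: (H2' s sT).
have dv s : IT T s -> L2_deriv_within T v (vt s) s.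
  move=> sT; apply: L2_deriv_withinB => //; try exact: deriv_L2_within.
  - by move=> {sT} s sT; have [_ /H1_L2] := H s sT.
  - by move=> {sT} s sT; have [_ /H1_L2] := H' s sT.
  - by case: (H2 s sT).
  - by case: (H2' s sT).
have mass s : IT T s -> ae01 (fun x => qt s x = - vx s x).
  move=> sT; apply: ae01_sub (ae01_and (eqs s sT) (eqs' s sT)) => x _ [[e1 _] [e2 _]].
  by rewrite /qt /vx !fctE; lra.
(* Subtracting the momentum equations identifies the abstract residual with the difference of the
   dampings. *)
have rE s : IT T s ->
    ae01 (fun x => (- (vt s + qx s)) x = d (m x s) - d (m' x s)).
  move=> sT; apply: ae01_sub (ae01_and (eqs s sT) (eqs' s sT)) => x _ [[_ e1] [_ e2]].
  by rewrite /vt /qx !fctE; lra.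
have r_coer s : IT T s ->
    ae01 (fun x => d0 * (v s x * v s x) <= (- (vt s + qx s)) x * v s x).
  move=> sT; apply: ae01_sub (rE s sT) => x _ ->.
  exact: (damping_coercive d_der d'_gt).
split.
  exact: (energy_nonincreasing d0_gt0 Hq Hv q0 qt2 vt2 dq dv mass r_coer tT).
move=> M mM; apply: (energy_decay d0_gt0 Hq Hv q0 qt2 vt2 dq dv mass r_coer) => //.
  exact: dLip_ge0.
move=> s sT; apply: (ae01_sub _ (rE s sT)) => x Ix ->; have [xM xM'] := mM s x sT Ix.
exact: (damping_lipschitz d2_ge0 pw_ge0 d_der d'_le).
Qed.

Lemma deriv_L2_shift T h u (ut : R -> R -> R) : 0 <= h -> deriv_L2 T u ut ->
  deriv_L2 (T - h) (fun x s => u x (s + h)) (fun x s => ut x (s + h)).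
Proof.
move=> hge0 du t tT e e0.
have sh s : IT (T - h) s -> IT T (s + h).
  by rewrite /IT/= !in_itv/= => /andP[s0 sT]; apply/andP; split; lra.
have [del del0 H] := du _ (sh _ tT) _ e0.
exists del => // s sT st; have := H _ (sh _ sT).
have -> : s + h - (t + h) = s - t by ring.
exact.
Qed.

Lemma trajectory_shift T h p m px mx pt mt : 0 <= h -> traj T p m px mx pt mt ->
  traj (T - h) (fun x s => p x (s + h)) (fun x s => m x (s + h))
    (fun x s => px x (s + h)) (fun x s => mx x (s + h))
    (fun x s => pt x (s + h)) (fun x s => mt x (s + h)).
Proof.
move=> hge0 [H H2 [dp dm] eqs bnd].
have sh s : IT (T - h) s -> IT T (s + h).
  by rewrite /IT/= !in_itv/= => /andP[s0 sT]; apply/andP; split; lra.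
by split=> [s /sh|s /sh||s /sh|s /sh]; [exact: H|exact: H2|
  split; exact: deriv_L2_shift|exact: eqs|exact: bnd].
Qed.

Lemma trajectory_restrict T S p m px mx pt mt : S <= T ->
  traj T p m px mx pt mt -> traj S p m px mx pt mt.
Proof.
move=> ST [H H2 [dp dm] eqs bnd].
have sub s : IT S s -> IT T s.
  by rewrite /IT/= !in_itv/= => /andP[-> sS]; exact: le_trans ST.
have dsub u (ut : R -> R -> R) : deriv_L2 T u ut -> deriv_L2 S u ut.
  move=> du t /sub tT e e0; have [del del0 K] := du t tT e e0.
  by exists del => // s /sub sT; exact: K.
by split=> [s /sub|s /sub||s /sub|s /sub]; [exact: H|exact: H2|
  split; exact: dsub|exact: eqs|exact: bnd].
Qed.

Lemma trajectory_steady T (pb mb pbx mbx : R -> R) :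
  is_steady d fb gb h0 h1 pb mb pbx mbx ->
  traj T (fun x _ => pb x) (fun x _ => mb x) (fun x _ => pbx x) (fun x _ => mbx x)
    (fun _ _ => 0) (fun _ _ => 0).
Proof.
move=> [Hp Hm eqs bnd]; have z2 := L2_cst (0 : R).
have d0' (u : R -> R) : deriv_L2 T (fun x _ => u x) (fun _ _ => 0).
  move=> t tT e e0; exists 1 => // s sT _.
  rewrite [X in X < _](_ : _ = ip (cst 0) (cst 0)); first by rewrite ip_cst mul0r.
  by apply: eq_Rintegral => x _; rewrite subrr mul0r subr0 expr2.
split=> // s sT; apply: ae01_sub eqs => x _ [e1 e2]; split; lra.
Qed.

(** Shifts go forward in time, hence the limit from the right and the restriction [t < T]. *)
Lemma quotient_energy_cvg T p m pt mt t :
  (forall s, IT T s -> L2 (p^~ s) /\ L2 (m^~ s)) ->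
  (forall s, IT T s -> L2 (pt^~ s) /\ L2 (mt^~ s)) ->
  deriv_L2 T p pt -> deriv_L2 T m mt -> 0 <= t < T ->
  E (h^-1 *: (p^~ (t + h) - p^~ t)) (h^-1 *: (m^~ (t + h) - m^~ t)) @[h --> 0^'+] -->
    E (pt^~ t) (mt^~ t).
Proof.
move=> H H2 dp dm /andP[t0 tT].
have tI : IT T t by rewrite /IT/= in_itv/= t0 ltW.
have thI : \forall h \near 0^'+, IT T (t + h).
  near=> h; rewrite /IT/= in_itv/=; apply/andP; split; first by rewrite addr_ge0.
  by rewrite -lerBrDl; near: h; apply: nbhs_right_le; rewrite subr_gt0.
have K u (ut : R -> R -> R) : (forall s, IT T s -> L2 (u^~ s)) -> L2 (ut^~ t) ->
    deriv_L2 T u ut ->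
    ip (h^-1 *: (u^~ (t + h) - u^~ t)) (h^-1 *: (u^~ (t + h) - u^~ t)) @[h --> 0^'+] -->
      ip (ut^~ t) (ut^~ t).
  move=> u2 ut2 du.
  have Q2 : \forall h \near 0^'+, L2 (h^-1 *: (u^~ (t + h) - u^~ t)).
    by near=> h; apply: L2Z; apply: L2B; apply: u2 => //; near: h.
  have Qc : L2norm (h^-1 *: (u^~ (t + h) - u^~ t) - ut^~ t) @[h --> 0^'+] --> 0.
    apply/cvgrPdist_lt => e e0; have e20 : 0 < e ^+ 2 by rewrite exprn_gt0.
    have [del del0 Hd] := du _ tI _ e20.
    near=> h; rewrite sub0r normrN ger0_norm ?L2norm_ge0//.
    rewrite -ltr_sqr ?nnegrE ?L2norm_ge0 ?(ltW e0)//.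
    have th : t + h - t = h by ring.
    rewrite -[X in X^-1]th -deriv_L2_quotient; apply: Hd; first by near: h.
    have hgt0 : 0 < h by near: h; exact: nbhs_right_gt.
    rewrite th gtr0_norm// hgt0/=; near: h; exact: nbhs_right_lt.
  exact: (bounded_bilinear_cvg _ (@bounded_bilinear_ip R)).
rewrite E_ip; apply: cvgD; apply: cvgMl; apply: K => //.
- by move=> s /H [].
- by case: (H2 _ tI).
- by move=> s /H [].
- by case: (H2 _ tI).
Unshelve. all: by end_near. Qed.

(** At the final time no forward shift stays in [[0, T]]; the estimate there is reached by
    continuity from the left. *)
Lemma energy_left_cvg T pt mt : 0 < T ->
  (forall s, IT T s -> L2 (pt^~ s) /\ L2 (mt^~ s)) ->
  cont_L2 T pt -> cont_L2 T mt ->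
  E (pt^~ s) (mt^~ s) @[s --> T^'-] --> E (pt^~ T) (mt^~ T).
Proof.
move=> T0 H2 cp cm.
have TI : IT T T by rewrite /IT/= in_itv/= lexx ltW.
have sI : \forall s \near T^'-, IT T s.
  near=> s; rewrite /IT/= in_itv/=; apply/andP; split.
    by near: s; exact: nbhs_left_ge.
  by near: s; exact: nbhs_left_le.
have K (u : R -> R -> R) : (forall s, IT T s -> L2 (u^~ s)) -> cont_L2 T u ->
    ip (u^~ s) (u^~ s) @[s --> T^'-] --> ip (u^~ T) (u^~ T).
  move=> u2 cu.
  have u2' : \forall s \near T^'-, L2 (u^~ s) by near=> s; apply: u2; near: s.
  have uc : L2norm (u^~ s - u^~ T) @[s --> T^'-] --> 0.
    apply/cvgrPdist_lt => e e0; have e20 : 0 < e ^+ 2 by rewrite exprn_gt0.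
    have [del del0 Hd] := cu _ TI _ e20.
    near=> s; rewrite sub0r normrN ger0_norm ?L2norm_ge0//.
    rewrite -ltr_sqr ?nnegrE ?L2norm_ge0 ?(ltW e0)// sqr_L2norm.
    apply: Hd; first by near: s.
    have sT : s < T by near: s; exact: nbhs_left_lt.
    rewrite ltr0_norm ?subr_lt0// opprB ltrBlDl -ltrBlDr.
    by near: s; apply: nbhs_left_gt; rewrite ltrBlDr ltrDl.
  by apply: (bounded_bilinear_cvg _ (@bounded_bilinear_ip R)) => //; exact: u2.
rewrite E_ip; apply: cvgD; apply: cvgMl; apply: K => //.
- by move=> s /H2 [].
- by move=> s /H2 [].
Unshelve. all: by end_near. Qed.

(** Both sides of the assumed inequality are quadratic in the increments, so division by the square
    of [h] produces difference quotients with unchanged [c] and [g]. *)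
Lemma velocity_energy T p m px mx pt mt (c g : R) : 0 < T ->
  traj T p m px mx pt mt -> cont_L2 T pt -> cont_L2 T mt ->
  (forall h t, 0 < h -> 0 <= t -> t + h <= T ->
    E (p^~ (t + h) - p^~ t) (m^~ (t + h) - m^~ t) <=
    c * E (p^~ h - p^~ 0) (m^~ h - m^~ 0) * expR (- (g * t))) ->
  forall t, IT T t ->
    E (pt^~ t) (mt^~ t) <= c * E (pt^~ 0) (mt^~ 0) * expR (- (g * t)).
Proof.
move=> T0 [H H2 [dp dm] _ _] cp cm hyp.
have HL2 s : IT T s -> L2 (p^~ s) /\ L2 (m^~ s).
  by move=> /H [/H1_L2 ? /H1_L2].
have Hlt t : 0 <= t < T ->
    E (pt^~ t) (mt^~ t) <= c * E (pt^~ 0) (mt^~ 0) * expR (- (g * t)).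
  move=> tT; have ct := quotient_energy_cvg HL2 H2 dp dm tT.
  have T0' : 0 <= (0 : R) < T by rewrite lexx T0.
  have c0 := quotient_energy_cvg HL2 H2 dp dm T0'.
  have c0' : c * E (h^-1 *: (p^~ (0 + h) - p^~ 0)) (h^-1 *: (m^~ (0 + h) - m^~ 0)) *
      expR (- (g * t)) @[h --> 0^'+] --> c * E (pt^~ 0) (mt^~ 0) * expR (- (g * t)).
    by apply: cvgMl; apply: cvgMr.
  move/andP: tT => [t0 tT].
  apply: (ler_cvg_to ct c0'); near=> h.
  have hgt0 : 0 < h by near: h; exact: nbhs_right_gt.
  have thT : t + h <= T.
    by rewrite -lerBrDl; near: h; apply: nbhs_right_le; rewrite subr_gt0.
  have I1 : IT T t by rewrite /IT/= in_itv/= t0 ltW.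
  have I2 : IT T (t + h) by rewrite /IT/= in_itv/= thT addr_ge0// ltW.
  have I3 : IT T h by rewrite /IT/= in_itv/= (ltW hgt0)/=; lra.
  have I4 := IT0 I3.
  have [p1 m1] := HL2 _ I1; have [p2 m2] := HL2 _ I2.
  have [p3 m3] := HL2 _ I3; have [p4 m4] := HL2 _ I4.
  rewrite !E_scale ?add0r; try exact: L2B.
  rewrite (_ : c * _ * _ = h^-1 ^+ 2 *
    (c * E (p^~ h - p^~ 0) (m^~ h - m^~ 0) * expR (- (g * t)))); last by ring.
  by rewrite ler_wpM2l ?sqr_ge0// hyp.
move=> t; rewrite /IT/= in_itv/= => /andP[t0]; rewrite le_eqVlt => /predU1P[->|tT]; last first.
  by apply: Hlt; rewrite t0.
have cT := energy_left_cvg T0 H2 cp cm.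
have eT : c * E (pt^~ 0) (mt^~ 0) * expR (- (g * s)) @[s --> T^'-] -->
    c * E (pt^~ 0) (mt^~ 0) * expR (- (g * T)).
  apply: cvgMr; apply: cvg_at_left_filter.
  apply: (@continuous_comp _ _ _ (fun s => - (g * s)) expR); last exact: continuous_expR.
  by apply: cvgN; apply: cvgMr; exact: cvg_id.
apply: (ler_cvg_to cT eT); near=> s; apply: Hlt; apply/andP; split.
  by near: s; exact: nbhs_left_ge.
by near: s; exact: nbhs_left_lt.
Unshelve. all: by end_near. Qed.

End trajectory_energy.

(** * Bounds in terms of the data *)

Section a_priori_bounds.
Context {R : realType}.
Variables (d : R -> R) (d0 d1 d2 pw : R).
Hypotheses (d0_gt0 : 0 < d0) (d1_ge0 : 0 <= d1) (d2_ge0 : 0 <= d2) (pw_ge0 : 0 <= pw).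
Hypothesis d_der : forall x, derivable d x 1.
Hypothesis d_0 : d 0 = 0.
Hypothesis d'_gt : forall x, @derive1 R R d x > d0.
Hypothesis d'_le : forall x, `|@derive1 R R d x| <= d1 + d2 * (`|x| `^ pw).
Variables (fb gb : R -> R) (h0 h1 : R).
Hypotheses (fb2 : L2 fb) (gb2 : L2 gb).

Let nf := L2norm fb.
Let ng := L2norm gb.
Let nh := Num.sqrt (h0 ^+ 2 + h1 ^+ 2).
Let L := dLip d1 d2 pw.

Lemma boundary_le : `|h0| <= nh /\ `|h1| <= nh.
Proof.
by split; rewrite -sqrtr_sqr ler_wsqrtr// ?lerDl ?lerDr sqr_ge0.
Qed.

Lemma damping_le M a : `|a| <= M -> `|d a| <= L M * M.
Proof.
move=> aM; have M0 : 0 <= M := le_trans (normr_ge0 a) aM.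
have := @damping_lipschitz _ d d1 d2 pw d2_ge0 pw_ge0 d_der d'_le M a 0 aM.
rewrite normr0 d_0 !subr0 => /(_ M0) /le_trans; apply.
by rewrite ler_wpM2l// dLip_ge0.
Qed.

(** With norms [a] of [fb], [b] of [gb] and [c] of the boundary data: [b + 2 * c] bounds the mean of
    [d(mb)], coercivity divides it by [d0], and the oscillation [a] of [mb] about [mb 0] is paid
    twice, to reach [mb 0] and to leave it. *)
Definition steady_bound (a b c : R) := (2 * c + b) / d0 + 2 * a.

Lemma steady_flux_le (pb mb pbx mbx : R -> R) :
  is_steady d fb gb h0 h1 pb mb pbx mbx ->
  forall x, I01 x -> `|mb x| <= steady_bound nf ng nh.
Proof.
move=> [Hp Hm eqs [pb0 pb1]].
have pbx2 := H1_L2' Hp; have mbx2 := H1_L2' Hm.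
have nmbx : L2norm mbx = nf.
  by apply: L2norm_ae => //; apply: ae01_sub eqs => x _ [].
have dev x : I01 x -> `|mb x - mb 0| <= nf.
  by move=> Ix; rewrite (H1E Hm Ix) addrC addKr -nmbx; exact: prim_le.
have [nh0 nh1] := boundary_le.
have nh_ge0 : 0 <= nh := sqrtr_ge0 _.
have d00 := d0_gt0.
have ng_ge0 : 0 <= ng := L2norm_ge0 _.
have w2 : L2 (gb - pbx) by exact: L2B.
have w_le : `|ip (gb - pbx) (cst 1)| <= ng + 2 * nh.
  rewrite ipBl// -[ip pbx _]prim1.
  have -> : prim pbx 1 = h1 - h0 by have := H1E Hp I011; rewrite pb0 pb1; lra.
  have := cauchy_schwarz_L2 gb2 (L2_cst 1); rewrite L2norm_cst normr1 mulr1 -/ng => h.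
  have := ler_normB (ip gb (cst 1)) (h1 - h0); have := ler_normB h1 h0; lra.
(* The sign [s] treats both bounds at once. If [s * mb 0] were larger, [s * mb] would be positive
   throughout, and coercivity would make the mean of [s * d(mb)] exceed its bound. *)
have K : forall s : R, s * s = 1 -> s * mb 0 <= (2 * nh + ng) / d0 + nf.
  move=> s ss; rewrite leNgt; apply/negP => mb0.
  have sn : `|s| = 1.
    by apply/eqP; rewrite -(@eqrXn2 _ 2)// expr1n real_normK ?num_real// expr2 ss.
  have : ip (cst (d0 * (s * mb 0 - nf))) (cst 1) <= ip (s *: (gb - pbx)) (cst 1).
    apply: ae_le_ip => //; first exact: L2Z.
    apply: ae01_sub eqs => x Ix [_ ex] /=; rewrite !mulr1 !fctE -[_ *: _]/(_ * _).
    have -> : gb x - pbx x = d (mb x) by lra.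
    have y : s * mb 0 - nf <= s * mb x.
      have : `|s * (mb x - mb 0)| <= nf by rewrite normrM sn mul1r; exact: dev.
      by rewrite mulrBr ler_norml => /andP[]; lra.
    have K0 : 0 <= (2 * nh + ng) / d0 by apply: divr_ge0; lra.
    have y0 : 0 < s * mb x by lra.
    have coer := damping_coercive d_der d'_gt (mb x) 0; rewrite d_0 !subr0 in coer.
    rewrite (le_trans (_ : _ <= d0 * (s * mb x)))//; first by rewrite ler_wpM2l// ltW.
    rewrite -(ler_pM2r y0).
    rewrite [leLHS](_ : _ = d0 * (mb x * mb x) * (s * s)); last by ring.
    rewrite [leRHS](_ : _ = d (mb x) * mb x * (s * s)); last by ring.
    by rewrite ss !mulr1.
  rewrite ip_cst mulr1 ipZl// => h.
  have := ler_norm (s * ip (gb - pbx) (cst 1)); rewrite normrM sn mul1r => h'.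
  have : d0 * ((2 * nh + ng) / d0) < d0 * (s * mb 0 - nf) by rewrite ltr_pM2l//; lra.
  rewrite mulrC divfK ?gt_eqF//; lra.
move=> x Ix; have := dev _ Ix.
have := K 1 (mulr1 1); have := K (-1); rewrite mulrNN mulr1 => /(_ erefl).
rewrite /steady_bound -/nf -/ng -/nh !ler_norml => k1 k2 /andP[k3 k4].
by apply/andP; split; lra.
Qed.

Lemma steady_pressure_le (pb mb pbx mbx : R -> R) :
  is_steady d fb gb h0 h1 pb mb pbx mbx ->
  let M := steady_bound nf ng nh in
  forall x, I01 x -> `|pb x| <= nh + (ng + L M * M).
Proof.
move=> st M x Ix; have mbM := steady_flux_le st; case: (st) => [Hp Hm eqs [pb0 pb1]].
have pbx2 := H1_L2' Hp; have [nh0 _] := boundary_le.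
have M0 : 0 <= M := le_trans (normr_ge0 _) (mbM _ I010).
have LM : 0 <= L M * M by rewrite mulr_ge0// dLip_ge0.
rewrite (H1E Hp Ix) pb0 (le_trans (ler_normD _ _))// lerD//.
apply: (le_trans (prim_le pbx2 Ix)).
rewrite -[pbx](subrK gb) (le_trans (L2normD (L2B pbx2 gb2) gb2))// addrC lerD2l.
apply: L2norm_le_ae => //; last exact: L2B.
apply: ae01_sub eqs => y Iy [_ ey]; rewrite fctE distrC.
have -> : gb y - pbx y = d (mb y) by lra.
by apply: damping_le; exact: mbM.
Qed.

Variables (p0 p0x m0 m0x : R -> R) (T : R) (p m px mx pt mt : R -> R -> R).
Hypotheses (Hp0 : H1 p0 p0x) (Hm0 : H1 m0 m0x) (T_gt0 : 0 < T).
Hypothesis sol : is_solution d fb gb h0 h1 p0 m0 T p m px mx pt mt.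
Let np := H1norm p0 p0x.
Let nm := H1norm m0 m0x.

Lemma solution_trajectory : trajectory d fb gb h0 h1 T p m px mx pt mt.
Proof. by case: sol => [[H _] [H2 dd _] eqs bnd _]; split. Qed.

Lemma initial_energy_le (pb mb : R -> R) (P M : R) : L2 pb -> L2 mb ->
  (forall x, I01 x -> `|pb x| <= P) -> (forall x, I01 x -> `|mb x| <= M) ->
  E (p^~ 0 - pb) (m^~ 0 - mb) <= ((np + P) ^+ 2 + (nm + M) ^+ 2) / 2.
Proof.
move=> pb2 mb2 pbP mbM; case: sol => _ _ _ _ init.
rewrite (@eq_E _ _ (p0 - pb) _ (m0 - mb)); last 2 first.
- by move=> x /init [e _]; rewrite !fctE e.
- by move=> x /init [_ e]; rewrite !fctE e.
have p02 := H1_L2 Hp0; have m02 := H1_L2 Hm0.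
have [np1 _] := H1norm_ge p0 p0x; have [nm1 _] := H1norm_ge m0 m0x.
by apply: E_le; rewrite (le_trans (L2normB _ _))// lerD// L2norm_le_bound.
Qed.

(** The equations at time 0 express the velocities through the initial data; [3 * nm] is the uniform
    bound on [m0] given by [H1_bound]. *)
Lemma initial_velocity_le :
  E (pt^~ 0) (mt^~ 0) <=
  ((nf + nm) ^+ 2 + (ng + np + L (3 * nm) * (3 * nm)) ^+ 2) / 2.
Proof.
case: sol => [[H _] [H2 _ _] eqs _ init].
have T0 : IT T 0 by rewrite /IT/= in_itv/= lexx ltW.
have [Hp Hm] := H _ T0; have [pt2 mt2] := H2 _ T0.
have px2 := H1_L2' Hp; have mx2 := H1_L2' Hm.
have npx : L2norm (px^~ 0) = L2norm p0x.
  apply: L2norm_ae (H1_L2' Hp0) _ => //; apply: H1_deriv_ae Hp Hp0 _.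
  by move=> x /init [].
have nmx : L2norm (mx^~ 0) = L2norm m0x.
  apply: L2norm_ae (H1_L2' Hm0) _ => //; apply: H1_deriv_ae Hm Hm0 _.
  by move=> x /init [].
have [_ np1] := H1norm_ge p0 p0x; have [nm0 nm1] := H1norm_ge m0 m0x.
have nm_ge0 : 0 <= nm := le_trans (L2norm_ge0 _) nm0.
have LM : 0 <= L (3 * nm) * (3 * nm) by rewrite mulr_ge0 ?dLip_ge0//; lra.
apply: E_le.
  rewrite (L2norm_ae pt2 (L2B fb2 mx2)); last first.
    by apply: ae01_sub (eqs _ T0) => x _ [e _]; rewrite !fctE; lra.
  by rewrite (le_trans (L2normB _ _))// lerD// nmx.
have w2 := L2B gb2 px2; have z2 := L2B w2 mt2.
(* The damping term is represented by the residual, already known to lie in L^2, so measurability of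
   the composition with [d] does not arise. *)
have -> : mt^~ 0 = (gb - px^~ 0) - (gb - px^~ 0 - mt^~ 0).
  by rewrite opprB addrC subrK.
rewrite (le_trans (L2normB _ _))// lerD//.
  by rewrite (le_trans (L2normB _ _))// lerD// npx.
apply: L2norm_le_ae => //; apply: ae01_sub (eqs _ T0) => x Ix [_ e].
rewrite !fctE (_ : _ - _ = d (m x 0)); last by lra.
apply: damping_le; have [_ ->] := init _ Ix.
by have := H1_bound Hm0 Ix; rewrite -/nm in nm0 nm1; lra.
Qed.

(** The square roots bound the L^2 norms of [m - mb] and of its space derivative; the factor 2 is
    that of [H1_bound]. *)
Lemma flux_le t x (mb mbx : R -> R) (pb pbx : R -> R) (M e e' : R) :
  IT T t -> I01 x -> is_steady d fb gb h0 h1 pb mb pbx mbx ->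
  `|mb x| <= M -> E (p^~ t - pb) (m^~ t - mb) <= e -> E (pt^~ t) (mt^~ t) <= e' ->
  `|m x t| <= M + Num.sqrt (2 * e) + 2 * Num.sqrt (2 * e').
Proof.
move=> tT Ix [_ Hmb eqsb _] mbM /L2norm_Esqrt[_ v_le] /L2norm_Esqrt[pt_le _].
case: sol => [[H _] [H2 _ _] eqs _ _].
have [_ Hm] := H _ tT; have [pt2 _] := H2 _ tT.
have Hv := H1B Hm Hmb; have := H1_bound Hv Ix.
rewrite (L2norm_ae (H1_L2' Hv) (L2N pt2)); last first.
  apply: ae01_sub (ae01_and (eqs _ tT) eqsb) => y _ [[e1 _] [e2 _]].
  by rewrite !fctE; lra.
rewrite L2normN// !fctE => vx.
have := ler_normD (m x t - mb x) (mb x); rewrite subrK; lra.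
Qed.

End a_priori_bounds.

(** * Choice of the constants and exponential decay *)

Unset Implicit Arguments.
Theorem theorem1 (R : realType) (d : R -> R) (d0 d1 d2 pw : R) :
  0 < d0 -> 0 <= d1 -> 0 <= d2 -> 0 <= pw ->
  (forall x, derivable d x 1) -> continuous (@derive1 R R d) ->
  d 0 = 0 ->
  (forall x, @derive1 R R d x > d0) ->
  (forall x, `|@derive1 R R d x| <= d1 + d2 * (`|x| `^ pw)) ->
  exists (C C' G : R -> R -> R -> R -> R -> R),
    (forall a b c e f, 0 < C a b c e f /\ 0 < C' a b c e f /\ 0 < G a b c e f) /\
    forall (fb gb : R -> R) (h0 h1 : R) (p0 p0x m0 m0x : R -> R) (T : R)
           (p m px mx pt mt : R -> R -> R) (pb mb pbx mbx : R -> R),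
      L2 fb -> L2 gb -> H1 p0 p0x -> H1 m0 m0x -> 0 < T ->
      is_solution d fb gb h0 h1 p0 m0 T p m px mx pt mt ->
      is_steady d fb gb h0 h1 pb mb pbx mbx ->
      let nf := L2norm fb in let ng := L2norm gb in
      let nh := Num.sqrt (h0 ^+ 2 + h1 ^+ 2) in
      let np := H1norm p0 p0x in let nm := H1norm m0 m0x in
      forall t, 0 <= t <= T ->
        E (fun x => p x t - pb x) (fun x => m x t - mb x)
          <= C nf ng nh np nm * expR (- (G nf ng nh np nm * t)) /\
        E (fun x => pt x t) (fun x => mt x t)
          <= C' nf ng nh np nm * expR (- (G nf ng nh np nm * t)).
Proof.
move=> d0p d1p d2p pwp d_der _ d_0 d'_gt d'_le.
pose L := dLip d1 d2 pw.
(* The arguments stand for the norms of [fb], [gb], the boundary data, [p0] and [m0], in this order.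
   [Mb] bounds the steady flux, [e] the initial energy of the difference, [e'] the initial energy of
   the velocities, and [M] the flux at all times. *)
pose Mb (a b c : R) := steady_bound d0 a b c.
pose e (a b c e f : R) := ((e + (c + (b + L (Mb a b c) * Mb a b c))) ^+ 2 +
  (f + Mb a b c) ^+ 2) / 2.
pose e' (a b c e f : R) := ((a + f) ^+ 2 + (b + e + L (3 * f) * (3 * f)) ^+ 2) / 2.
pose M (a b c g f : R) :=
  Mb a b c + Num.sqrt (2 * e a b c g f) + 2 * Num.sqrt (2 * e' a b c g f).
(* The summand 1 keeps the constants positive even when all data vanish. *)
exists (fun a b c g f => 3 * e a b c g f + 1), (fun a b c g f => 3 * e' a b c g f + 1),
  (fun a b c g f => decay_rate d0 (L (M a b c g f))).
split=> [a b c g f|].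
  have h1 : 0 <= e a b c g f by rewrite divr_ge0// addr_ge0// sqr_ge0.
  have h2 : 0 <= e' a b c g f by rewrite divr_ge0// addr_ge0// sqr_ge0.
  do 2!(split; first by lra).
  have := sqr_ge0 (L (M a b c g f)); rewrite /decay_rate => h3.
  by rewrite !divr_gt0//; lra.
move=> fb gb h0 h1 p0 p0x m0 m0x T p m px mx pt mt pb mb pbx mbx.
move=> fb2 gb2 Hp0 Hm0 T0 sol st nf ng nh np nm t t0T.
have tT : IT T t by rewrite /IT/= in_itv/=.
have zT := IT0 tT.
have tr := solution_trajectory sol.
have trs := trajectory_steady T st.
have mbM := steady_flux_le d0p d_der d_0 d'_gt fb2 gb2 st.
have pbP := steady_pressure_le d0p d1p d2p pwp d_der d_0 d'_gt d'_le fb2 gb2 st.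
case: (st) => Hpb Hmb _ _; case: (sol) => _ [_ _ [cp cm]] _ _ _.
have e0 := initial_energy_le Hp0 Hm0 sol (H1_L2 Hpb) (H1_L2 Hmb) pbP mbM.
have e'0 := initial_velocity_le d1p d2p pwp d_der d_0 d'_le fb2 gb2 Hp0 Hm0 T0 sol.
have shifted h : 0 < h -> h <= T -> trajectory d fb gb h0 h1 (T - h)
    (fun x s => p x (s + h)) (fun x s => m x (s + h))
    (fun x s => px x (s + h)) (fun x s => mx x (s + h))
    (fun x s => pt x (s + h)) (fun x s => mt x (s + h)).
  by move=> hp hT; apply: trajectory_shift (ltW hp) tr.
have restricted h : 0 < h -> trajectory d fb gb h0 h1 (T - h) p m px mx pt mt.
  by move=> hp; apply: trajectory_restrict tr; lra.
have ITh h s : 0 <= s -> s + h <= T -> IT (T - h) s.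
  by move=> s0 sT; rewrite /IT/= in_itv/= s0/=; lra.
have vel s : IT T s -> E (pt^~ s) (mt^~ s) <= e' nf ng nh np nm.
  move=> sT; apply: le_trans e'0.
  (* Here [c = 1] and [g = 0]: monotonicity only, as no bound on [m] is available yet. *)
  have := @velocity_energy _ d fb gb h0 h1 T p m px mx pt mt 1 0 T0 tr cp cm _ s sT.
  rewrite mul0r oppr0 expR0 mul1r mulr1; apply=> h r hp r0 rhT.
  rewrite mul0r oppr0 expR0 mul1r mulr1.
  have hT : h <= T by lra.
  have [+ _] := trajectory_diff d0p d1p d2p pwp d_der d'_gt d'_le
    (shifted h hp hT) (restricted h hp) (ITh _ _ r0 rhT).
  by rewrite add0r.
have mM s x : IT T s -> I01 x -> `|m x s| <= M nf ng nh np nm.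
  move=> sT Ix; apply: (flux_le sol sT Ix st (mbM _ Ix) _ (vel _ sT)).
  apply: le_trans e0.
  by have [] := trajectory_diff d0p d1p d2p pwp d_der d'_gt d'_le tr trs sT.
have mbM' x : I01 x -> `|mb x| <= M nf ng nh np nm.
  move=> /mbM /le_trans; apply; rewrite /M -addrA lerDl.
  by apply: addr_ge0; [|apply: mulr_ge0 => //]; exact: sqrtr_ge0.
have ex := expR_gt0 (- (decay_rate d0 (L (M nf ng nh np nm)) * t)).
split.
  have [_] := trajectory_diff d0p d1p d2p pwp d_der d'_gt d'_le tr trs tT.
  move=> /(_ (M nf ng nh np nm)) K; apply: le_trans (K _) _.
    by move=> s x sT Ix; split; [exact: mM|exact: mbM'].
  by rewrite ler_pM2r// (le_trans (_ : _ <= 3 * e nf ng nh np nm)) ?lerDl// ler_pM2l.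
apply: (@le_trans _ _ (3 * E (pt^~ 0) (mt^~ 0) *
    expR (- (decay_rate d0 (L (M nf ng nh np nm)) * t)))); last first.
  by rewrite ler_pM2r// (le_trans (_ : _ <= 3 * e' nf ng nh np nm)) ?lerDl// ler_pM2l.
apply: (@velocity_energy _ d fb gb h0 h1 T p m px mx pt mt) => //.
move=> h r hp r0 rhT; have hT : h <= T by lra.
have [_] := trajectory_diff d0p d1p d2p pwp d_der d'_gt d'_le
  (shifted h hp hT) (restricted h hp) (ITh _ _ r0 rhT).
(* For [s] in [[0, T - h]] both [s] and [s + h] lie in [[0, T]], so [mM] bounds both trajectories by
   the same [M]. *)
move=> /(_ (M nf ng nh np nm)); rewrite add0r; apply=> s x.
rewrite /IT/= in_itv/= => /andP[s0 sT] Ix.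
by split; apply: mM => //; rewrite /IT/= in_itv/=; apply/andP; split; lra.
Qed.
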